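(* Let $2\le n\le d$ be integers, $a\in\mathbb{R}$ with $a+n\in(0,2)$, and $\varepsilon\ge0$. Let $A\in\mathbb{R}^{d,d}$ be a constant symmetric matrix such that $\lambda|\xi|^2\le A\xi\cdot\xi\le\Lambda|\xi|^2$ for all $\xi\in\mathbb{R}^d$, for some constants $0<\lambda\le\Lambda<\infty$. Let $u$ be an entire solution to $$\begin{cases}-\operatorname{div}(|y|^aA\nabla u)=0&\text{in }\mathbb{R}^d\setminus\Sigma_\varepsilon,\\ u=0&\text{on }\partial\Sigma_\varepsilon.\end{cases}$$ Assume that there exist constants $c>0$ and $\gamma\in(0,2-a-n)$ such that $$|u(z)|\le c(1+|z|^\gamma)\quad\text{for a.e. }z\in\mathbb{R}^d\setminus\Sigma_\varepsilon.$$ Then $u$ is identically zero.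
   Context: Points of $\mathbb{R}^d$ are written $z=(x,y)\in\mathbb{R}^{d-n}\times\mathbb{R}^n$; $B_R=\{z\in\mathbb{R}^d:|z|<R\}$; for $\varepsilon\ge0$, $\Sigma_\varepsilon=\{(x,y)\in\mathbb{R}^d:|y|\le\varepsilon\}$ and $\partial\Sigma_\varepsilon=\{(x,y):|y|=\varepsilon\}$ (for $\varepsilon=0$ both are $\Sigma_0=\{|y|=0\}$). $\tilde H^{1,a}(B_R\setminus\Sigma_\varepsilon)$ is the completion of $C_c^\infty(\overline{B_R}\setminus\Sigma_\varepsilon)$ (functions smooth up to $\partial B_R$ and vanishing near $\Sigma_\varepsilon$) with respect to the norm $\big(\int_{B_R\setminus\Sigma_\varepsilon}|y|^au^2\,dz+\int_{B_R\setminus\Sigma_\varepsilon}|y|^a|\nabla u|^2\,dz\big)^{1/2}$. Entire solution: $u$ is an entire solution to the problem in the claim if for every $R>0$ (nontrivially when $R>\varepsilon$) one has $u\in\tilde H^{1,a}(B_R\setminus\Sigma_\varepsilon)$ and $$\int_{B_R\setminus\Sigma_\varepsilon}|y|^aA\nabla u\cdot\nabla\phi\,dz=0\quad\text{for every }\phi\in C_c^\infty(B_R\setminus\Sigma_\varepsilon).$$ *)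

(* Defs.v *)
From HB Require Import structures.
From mathcomp Require Import all_boot all_order all_algebra.
From mathcomp Require Import all_classical all_reals all_analysis.

Set Implicit Arguments.
Unset Strict Implicit.
Unset Printing Implicit Defensive.
Import Order.TTheory GRing.Theory Num.Theory.
Import numFieldNormedType.Exports.

Local Open Scope classical_set_scope.
Local Open Scope ring_scope.

Definition row_display : measure_display -> measure_display.
Proof. exact. Qed.

(* Same construction as the library's sigma-algebra on n.-tuple T: the one
   generated by the coordinates, which on 'rV[R]_n is the Borel one. *)
Section measurable_row.
Context {d} {T : sigmaRingType d} (n : nat).

Definition row_coord (i : 'I_n) (x : 'rV[T]_n) : T := x ord0 i.

Let row_set0 : g_sigma_preimage row_coord set0.
Proof. exact: sigma_algebra0. Qed.

Let row_setC A : g_sigma_preimage row_coord A -> g_sigma_preimage row_coord (~` A).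
Proof. exact: sigma_algebraC. Qed.

Let row_bigcup (F : _^nat) : (forall i, g_sigma_preimage row_coord (F i)) ->
  g_sigma_preimage row_coord (\bigcup_i (F i)).
Proof. exact: sigma_algebra_bigcup. Qed.

HB.instance Definition _ := @isMeasurable.Build (row_display d)
  'rV[T]_n (g_sigma_preimage row_coord) row_set0 row_setC row_bigcup.
End measurable_row.


Lemma measurable_row_coord d (T : measurableType d) n (i : 'I_n) :
  measurable_fun [set: 'rV[T]_n] (row_coord i).
Proof.
move=> _ Y mY; rewrite setTI; apply: sub_sigma_algebra => /=.
rewrite -bigcup_seq/=; exists i => /=; first by rewrite mem_index_enum.
by exists Y => //; rewrite setTI.
Qed.

Lemma measurable_fun_rowP d (T : measurableType d) (R : realType) n
    (f : T -> 'rV[R]_n) :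
  measurable_fun [set: T] f <->
  forall i, measurable_fun [set: T] (row_coord i \o f).
Proof.
split=> [mf i|mf].
  by apply: measurableT_comp => //; exact: measurable_row_coord.
suff h : g_sigma_preimage (fun i => row_coord i \o f) `<=` measurable.
  move=> _ A mA; apply: h; rewrite g_sigma_preimage_comp.
  by exists A => //.
apply: smallest_sub; first exact: sigma_algebra_measurable.
move=> A; rewrite -bigcup_seq/= => -[i _ [B mB <-]].
exact: mf.
Qed.

Section lebesgue_row.
Context {R : realType}.

Definition row_cons n (p : measurableTypeR R * 'rV[R]_n) : 'rV[R]_n.+1 :=
  \row_i if unlift ord0 i is Some j then p.2 ord0 j else p.1.

Definition row_uncons n (x : 'rV[R]_n.+1) : measurableTypeR R * 'rV[R]_n :=
  (x ord0 ord0, \row_j x ord0 (lift ord0 j)).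

Lemma row_consK n : cancel (@row_cons n) (@row_uncons n).
Proof.
case=> a x; rewrite /row_uncons /row_cons !mxE unlift_none /=; congr pair.
by apply/rowP => j; rewrite !mxE liftK.
Qed.

Lemma measurable_row_cons n : measurable_fun setT (@row_cons n).
Proof.
apply/measurable_fun_rowP => i; rewrite /comp /row_coord.
case: (unliftP ord0 i) => [j|] ij.
  rewrite (_ : (fun _ => _) = row_coord j \o snd).
    by apply: measurableT_comp => //; exact: measurable_row_coord.
  by apply/funext => p; rewrite /= mxE ij liftK.
rewrite (_ : (fun _ => _) = fst) //.
by apply/funext => p; rewrite /= mxE ij unlift_none.
Qed.

Lemma measurable_row_uncons n : measurable_fun setT (@row_uncons n).
Proof.
apply/measurable_fun_pairP; split.
  exact: (measurable_row_coord ord0).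
apply/measurable_fun_rowP => i.
rewrite (_ : _ \o _ = row_coord (lift ord0 i)).
  exact: measurable_row_coord.
by apply/funext => x; rewrite /= /row_coord mxE.
Qed.

Section step.
Context n (m : {sigma_finite_measure set 'rV[R]_n -> \bar R}).

Definition lebesgue_row_step : set 'rV[R]_n.+1 -> \bar R :=
  pushforward (lebesgue_measure \x m)%E (@row_cons n).

Let step0 : lebesgue_row_step set0 = 0%E.
Proof. by rewrite /lebesgue_row_step /pushforward preimage_set0 measure0. Qed.

Let step_ge0 A : (0 <= lebesgue_row_step A)%E.
Proof. by rewrite /lebesgue_row_step /pushforward measure_ge0. Qed.

Let step_sigma_additive : semi_sigma_additive lebesgue_row_step.
Proof.
exact: (@measure_semi_sigma_additive _ _ _
  (measure_function_pushforward__canonical__measure_function_Measure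
     (lebesgue_measure \x m)%E (@measurable_row_cons n))).
Qed.

HB.instance Definition _ := isMeasure.Build _ _ _ lebesgue_row_step
  step0 step_ge0 step_sigma_additive.

Let step_sigma_finite : sigma_finite setT lebesgue_row_step.
Proof.
have /sigma_finiteP[F [FT ndF Foo]] := sigma_finiteT (@lebesgue_measure R).
have /sigma_finiteP[G [GT ndG Goo]] := sigma_finiteT m.
exists (fun k => @row_uncons n @^-1` (F k `*` G k)) => [|k].
  rewrite -preimage_bigcup (_ : \bigcup_k _ = setT) ?preimage_setT//.
  rewrite -setXTT FT GT predeqE => -[x y]; split.
    by move=> [k _ []/= ? ?]; split; exists k.
  move=> [/= [i _ Fix] [k _ Gky]]; exists (maxn i k) => //; split.
  - by move: x Fix; exact/subsetPset/ndF/leq_maxl.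
  - by move: y Gky; exact/subsetPset/ndG/leq_maxr.
have [mF Fk] := Foo k; have [mG Gk] := Goo k.
have mFG : measurable (F k `*` G k) by exact: measurableX.
split.
  rewrite -[X in measurable X]setTI.
  exact: (measurable_row_uncons measurableT mFG).
rewrite /lebesgue_row_step /pushforward -comp_preimage.
rewrite (_ : _ \o _ = id); last by apply/funext => p; exact: row_consK.
by rewrite preimage_id product_measure1E// lte_mul_pinfty// ge0_fin_numE.
Qed.

HB.instance Definition _ := Measure_isSigmaFinite.Build _ _ _
  lebesgue_row_step step_sigma_finite.
End step.

(* Lebesgue measure on R^n, as an iterated product; see lebesgue_row_box. *)
Fixpoint lebesgue_row n : {sigma_finite_measure set 'rV[R]_n -> \bar R} :=
  if n is n'.+1 then lebesgue_row_step (lebesgue_row n') else dirac (0 : 'rV[R]_0).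

Lemma lebesgue_row_box n (A : 'I_n -> set R) :
  (forall i, measurable (A i)) ->
  lebesgue_row n [set x | forall i, A i (x ord0 i)] =
  (\prod_(i < n) lebesgue_measure (A i))%E.
Proof.
elim: n A => [|n IHn] A mA.
  by rewrite big_ord0 /= diracE mem_set // => -[].
have mB : measurable
    [set x : 'rV[R]_n | forall i, A (lift ord0 i) (x ord0 i)].
  rewrite (_ : [set x | _] =
      \bigcap_(i in [set: 'I_n]) (row_coord i @^-1` A (lift ord0 i))).
    apply: fin_bigcap_measurable => // i _.
    by rewrite -[X in measurable X]setTI; exact: measurable_row_coord.
  by apply/seteqP; split=> x /= h i; [move=> _|]; exact: h.
rewrite big_ord_recl -IHn//= -product_measure1E//; last exact: mA.
rewrite /lebesgue_row_step /pushforward; congr (product_measure1 _ _ _).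
apply/seteqP; split=> -[x y] /=.
  move=> h; split=> [|i].
    by have := h ord0; rewrite mxE unlift_none.
  by have := h (lift ord0 i); rewrite mxE liftK.
move=> [h0 h] i; rewrite mxE.
by case: unliftP => [j ->|->] //=; exact: h.
Qed.
End lebesgue_row.

Section notions.
Context {R : realType}.

Definition dotr d (v w : 'rV[R]_d) : R := \sum_i v ord0 i * w ord0 i.

(* The library norm on 'rV[R]_d is the sup norm. *)
Definition enorm d (z : 'rV[R]_d) : R := Num.sqrt (dotr z z).

(* The row vector with entries (A xi)_i. *)
Definition mxact d (A : 'M[R]_d) (xi : 'rV[R]_d) : 'rV[R]_d := xi *m A^T.

(* |y| for z = (x, y), where y is made of the last n coordinates of z. *)
Definition ynorm d n (z : 'rV[R]_d) : R :=
  Num.sqrt (\sum_(i < d | (d - n <= i)%N) z ord0 i ^+ 2).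

Definition eball d (r : R) : set 'rV[R]_d := [set z | enorm z < r].

Definition eclosed_ball d (r : R) : set 'rV[R]_d := [set z | enorm z <= r].

Definition Sigma d n (eps : R) : set 'rV[R]_d := [set z | ynorm n z <= eps].

Definition weight d n (a : R) (z : 'rV[R]_d) : R := ynorm n z `^ a.

Definition pder d (i : 'I_d) (f : 'rV[R]_d -> R) : 'rV[R]_d -> R :=
  fun z => 'D_(delta_mx ord0 i) f z.

Definition grad d (f : 'rV[R]_d -> R) (z : 'rV[R]_d) : 'rV[R]_d :=
  \row_i pder i f z.

Definition iter_pder d (s : seq 'I_d) (f : 'rV[R]_d -> R) : 'rV[R]_d -> R :=
  foldr (@pder d) f s.

Definition smooth d (f : 'rV[R]_d -> R) : Prop :=
  forall s : seq 'I_d, continuous (iter_pder s f) /\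
    forall z i, derivable (iter_pder s f) z (delta_mx ord0 i).

(* C_c^oo(U) for a possibly non-open U: functions whose restriction to U is the
   restriction of a smooth function on R^d and vanishes on U outside a compact
   subset of U. Values outside U are irrelevant. For U = closed ball \ Sigma_eps
   these are the functions smooth up to the sphere and vanishing near
   Sigma_eps. *)
Definition smooth_cpt d (U : set 'rV[R]_d) (f : 'rV[R]_d -> R) : Prop :=
  smooth f /\
  exists K, [/\ compact K, K `<=` U & forall z, U z -> ~ K z -> f z = 0].

(* The weighted norm over B_r \ Sigma_eps of a pair (function, gradient). *)
Definition wnorm d n (a eps r : R) (u : 'rV[R]_d -> R)
    (Du : 'rV[R]_d -> 'rV[R]_d) : \bar R :=
  ((\int[lebesgue_row d]_(z in eball r `\` Sigma n eps)
      (weight n a z * u z ^+ 2)%:E +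
    \int[lebesgue_row d]_(z in eball r `\` Sigma n eps)
      (weight n a z * enorm (Du z) ^+ 2)%:E) `^ 2^-1)%E.

(* u belongs to \tilde H^{1,a}(B_r \ Sigma_eps) with gradient Du. By
   completeness of the weighted L^2 spaces, the completion is realized by the
   limits (u, Du) of the pairs (phi_k, grad phi_k) for the weighted norm.
   Elements are classes modulo null sets: u and Du are Borel representatives,
   without which the integrals would not be meaningful. *)
Definition tildeH_grad d n (a eps r : R) (u : 'rV[R]_d -> R)
    (Du : 'rV[R]_d -> 'rV[R]_d) : Prop :=
  [/\ measurable_fun (eball r `\` Sigma n eps) u,
      measurable_fun (eball r `\` Sigma n eps) Du &
      exists phi : nat -> 'rV[R]_d -> R,
        (forall k, smooth_cpt (eclosed_ball r `\` Sigma n eps) (phi k)) /\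
        wnorm n a eps r (fun z => u z - phi k z)
          (fun z => Du z - grad (phi k) z) @[k --> \oo] --> 0%E].

(* Entire solution of - div (|y|^a A grad u) = 0 off Sigma_eps, u = 0 on its
   boundary, the Dirichlet condition being contained in tildeH_grad. The
   gradient Du is unique almost everywhere. *)
Definition entire_solution d n (a eps : R) (A : 'M[R]_d) (u : 'rV[R]_d -> R) :=
  forall r : R, 0 < r -> exists2 Du, tildeH_grad n a eps r u Du &
    forall phi, smooth_cpt (eball r `\` Sigma n eps) phi ->
      (\int[lebesgue_row d]_(z in eball r `\` Sigma n eps)
        (weight n a z * dotr (mxact A (Du z)) (grad phi z))%:E = 0)%E.

End notions.

(* Main.v *)
Require Import Defs.
From HB Require Import structures.
From mathcomp Require Import all_boot all_order all_algebra.
From mathcomp Require Import all_classical all_reals all_analysis.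
From mathcomp Require Import measurable_realfun ring lra.

Set Implicit Arguments.
Unset Strict Implicit.
Unset Printing Implicit Defensive.
Import Order.TTheory GRing.Theory Num.Theory.
Import numFieldNormedType.Exports.

Local Open Scope classical_set_scope.
Local Open Scope ring_scope.

(** Write w = |y|^a, sigma = 2 - a - n and P(z) = A^-1 z . z. The number sigma is
    the degree of the homogeneous solutions that depend on y only and vanish on
    {y = 0}: if C is the inverse of the y-block of A, extended by zero, and
    q(z) = C z . z, then A grad q has y-component 2 y, hence
    div (w A grad q^(s/2)) = s (s - sigma) w q^(s/2 - 1), which is 0 for s = sigma
    and negative for 0 < s < sigma. A solution that vanishes on Sigma_eps and grows slower than |z|^sigma has to be zero, and a
    single weighted energy estimate shows it.

    Let rho = F(P) with F >= 0 compactly supported. Testing the equation with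
    u rho gives int w A grad u . grad (u rho) = 0. For smooth f vanishing near
    Sigma_eps, expand A (grad f - f g) . (grad f - f g) >= 0 with
    g = grad log q^(sigma/2) = sigma C z / q, multiply by w rho, and add the
    divergence of the compactly supported field w f^2 (rho A g + F'(P) z), whose
    integral vanishes. The singular terms in 1/q cancel exactly, and A remains in the
    lower bound only through P (hardy_pointwise):

      int w A grad f . grad (f rho) >= int w f^2 h(P),
      h(t) = - (d + a + 2 sigma) F'(t) - 2 t F''(t).

    As u is a limit of such f in the energy norm, int w u^2 h(P) <= 0
    (weighted_energy_inequality).

    Put m = d + a + 2 sigma - 2 > 0. For F(t) = (1 + t)^(-m/2) one finds
    h(t) = m (m + 2) (1 + t)^(-m/2 - 2) / 2 > 0. Cutting F off smoothly between
    T/2 and T spoils the sign only there, by |h| = O(T^(-m/2 - 1))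
    (profile_h_inner, profile_h_annulus). On the other hand the growth of u and
    |y|^a <= prod |y_i|^(a/n) give int_{P <= T} w u^2 = O(T^(gamma + (d + a)/2))
    (level_mass). Since - m/2 - 1 + (d + a)/2 = - sigma, for each fixed T0

      int_{P <= T0} w u^2 <= K T^(gamma - sigma) for all large T,

    and the right-hand side tends to 0 (level_vanish). *)

(** * Derivatives along lines, and functions flat at the origin *)

Section calculus_on_lines.
Context {R : realType}.

(** A directional derivative is the derivative at 0 of a function of one real
    variable; the one-variable chain rule then applies to functions on a normed
    module that need not be differentiable there. *)
Lemma is_derive_lineP (V : normedModType R) (f : V -> R) (z v : V) (df : R) :
  is_derive z v f df <-> is_derive (0 : R) 1 (fun h : R => f (h *: v + z)) df.
Proof.
have E : (fun h : R => h^-1 *: ((f \o shift z) (h *: v) - f z)) =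
  (fun h : R => h^-1 *: (((fun h : R => f (h *: v + z)) \o shift 0) (h *: 1)
                         - f (0 *: v + z))).
  apply/funext => h /=; rewrite scale0r add0r addr0; congr (_ *: (f (_ *: _ + _) - _)).
  by rewrite [RHS]mulr1.
split=> -[df1 df2]; split.
- by rewrite /derivable -E.
- by rewrite /derive -E.
- by rewrite /derivable E.
- by rewrite /derive E.
Qed.

Lemma is_derive_lcomp (V : normedModType R) (F : R -> R) (f : V -> R) (z v : V)
    (dF df : R) :
  is_derive (f z) 1 F dF -> is_derive z v f df ->
  is_derive z v (fun x => F (f x)) (dF * df).
Proof.
move=> HF /is_derive_lineP Hf; apply/is_derive_lineP.
apply: (@is_derive1_comp R F (fun h : R => f (h *: v + z)) 0 dF df) => //.
by rewrite scale0r add0r.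
Qed.

Lemma is_deriveM_fun (V : normedModType R) (f g : V -> R) (z v : V) (df dg : R) :
  is_derive z v f df -> is_derive z v g dg ->
  is_derive z v (fun x => f x * g x) (f z * dg + df * g z).
Proof.
move=> Hf Hg; apply: (is_derive_eq (is_deriveM Hf Hg)).
by rewrite [df * _]mulrC.
Qed.

Lemma is_deriveD_fun (V : normedModType R) (f g : V -> R) (z v : V) (df dg : R) :
  is_derive z v f df -> is_derive z v g dg ->
  is_derive z v (fun x => f x + g x) (df + dg).
Proof. by move=> Hf Hg; exact: is_deriveD Hf Hg. Qed.

End calculus_on_lines.

Section flat_functions.
Context {R : realType}.

(** For positive t this is t^-k e^(-1/t). The family is closed under
    differentiation up to linear combinations (flat_derive), so that all its
    members are smooth although they vanish on a half-line. *)
Definition flat (k : nat) (t : R) : R :=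
  if 0 < t then t^-1 ^+ k * expR (- t^-1) else 0.

Lemma flat_le0 k (t : R) : t <= 0 -> flat k t = 0.
Proof. by rewrite /flat leNgt => /negbTE ->. Qed.

Lemma flat_gt0 k (t : R) : 0 < t -> 0 < flat k t.
Proof.
by move=> t0; rewrite /flat t0 mulr_gt0 ?expR_gt0 ?exprn_gt0 ?invr_gt0.
Qed.

Lemma flat_ge0 k (t : R) : 0 <= flat k t.
Proof. by case: (ltP 0 t) => [/(flat_gt0 k)/ltW|/(flat_le0 k) ->]. Qed.

(** With x = 1/t this says x^(k+1) <= (k+1)^(k+1) e^x, that is, the power k+1 of
    1 + y <= e^y at y = x/(k+1). The linear bound in t at every order k is what
    makes all the derivatives at 0 vanish. *)
Lemma flat_le (k : nat) (t : R) : 0 <= t -> flat k t <= (k.+1)%:R ^+ k.+1 * t.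
Proof.
rewrite le_eqVlt => /predU1P[<-|t0]; first by rewrite flat_le0 ?mulr0.
rewrite /flat t0.
have k0 : 0 < (k.+1)%:R :> R by rewrite ltr0n.
have h : (t^-1 / k.+1%:R) ^+ k.+1 <= expR t^-1.
  rewrite -[X in expR X](divfK (lt0r_neq0 k0)) expRM_natr.
  rewrite lerXn2r ?nnegrE ?divr_ge0 ?invr_ge0 ?ltW ?expR_gt0//.
  by apply: lt_le_trans (expR_ge1Dx _); rewrite ltrDr.
rewrite expRN ler_pdivrMr ?expR_gt0//.
have -> : t^-1 ^+ k = (k.+1)%:R ^+ k.+1 * t * (t^-1 / k.+1%:R) ^+ k.+1.
  rewrite expr_div_n [t^-1 ^+ k.+1]exprS; field.
  by rewrite ?expf_neq0 ?lt0r_neq0 //.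
by rewrite ler_pM2l// mulr_gt0// exprn_gt0.
Qed.

Lemma flat_derive (k : nat) (t : R) :
  is_derive t 1 (flat k) (flat k.+2 t - k%:R * flat k.+1 t).
Proof.
case: (ltgtP t 0) => t0.
- rewrite !flat_le0 ?(ltW t0)// mulr0 subr0.
  apply: (near_eq_is_derive (f := cst 0)).
  near=> x; rewrite /= flat_le0//; apply: ltW; near: x; exact: lt_nbhsl.
- rewrite /flat t0.
  apply: (near_eq_is_derive (f := fun t : R => t^-1 ^+ k * expR (- t^-1))).
    near=> x; rewrite ifT//; near: x; exact: lt_nbhsr.
  have Hi : is_derive t 1 (fun t : R => t^-1) (- t ^- 2).
    apply: (is_derive_eq (@is_deriveV R id t 1 1 (lt0r_neq0 t0) (is_derive_id _ _))).
    exact: mulr1.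
  have HX : is_derive t 1 (fun t : R => t^-1 ^+ k) (k%:R * t^-1 ^+ k.-1 * - t ^- 2).
    apply: (is_derive_lcomp (F := fun x : R => x ^+ k)) => //.
    have := is_deriveX k (is_derive_id (t^-1) (1 : R)).
    by rewrite exprfctE => /is_derive_eq; apply; rewrite [LHS]mulr1.
  have HN : is_derive t 1 (fun t : R => - t^-1) (t ^- 2).
    by have := is_deriveN Hi; rewrite opprK.
  have HE := is_derive_lcomp (f := fun t : R => - t^-1) (is_derive_expR _) HN.
  apply: (is_derive_eq (is_deriveM_fun HX HE)).
  case: k {HX} => [|k] /=.
    by rewrite !mul0r expr0 addr0 mul1r subr0 exprVn mulrC.
  rewrite 3![in RHS]exprS [t^-1 ^+ k.+1]exprS exprVn.
  by field; rewrite ?expf_neq0 ?lt0r_neq0.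
- rewrite t0 !flat_le0// mulr0 subr0.
  have H : (fun h : R => h^-1 *: ((flat k \o shift 0) (h *: 1) - flat k 0)) @ 0^' --> (0 : R).
    apply/cvgr0Pnorm_lt => e e0.
    pose C : R := (k.+2)%:R ^+ k.+2.
    have C0 : 0 < C by rewrite exprn_gt0// ltr0n.
    near=> h.
    rewrite /= (flat_le0 k (lexx 0)) subr0 addr0 [h *: 1]mulr1.
    have [h0|h0] := leP h 0; first by rewrite flat_le0// scaler0 normr0.
    have -> : h^-1 *: flat k h = flat k.+1 h.
      by rewrite /flat h0 [LHS]mulrA exprS.
    rewrite ger0_norm ?flat_ge0//; apply: le_lt_trans (flat_le _ (ltW h0)) _.
    rewrite -/C mulrC -ltr_pdivlMr//.
    have : `|h| < e / C.
      near: h; apply: dnbhs0_lt; exact: divr_gt0.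
    by apply: le_lt_trans; exact: ler_norm.
  by split; [apply/cvg_ex; exists 0|exact: cvg_lim H].
Unshelve. all: by end_near. Qed.

Lemma flat_continuous k : continuous (flat k).
Proof.
by move=> t; apply: differentiable_continuous; apply/derivable1_diffP;
   case: (flat_derive k t).
Qed.

Lemma flat0_le (x y : R) : x <= y -> flat 0 x <= flat 0 y.
Proof.
move=> xy; have [x0|x0] := leP x 0; first by rewrite flat_le0// flat_ge0.
have y0 := lt_le_trans x0 xy.
by rewrite /flat x0 y0 !expr0 !mul1r ler_expR lerN2 lef_pV2 ?posrE.
Qed.
End flat_functions.

(** * Smooth functions built from elementary ones *)

Section smooth_class.
Context {R : realType} (d : nat).
Implicit Types (f g : 'rV[R]_d -> R) (i : 'I_d).

(** Smoothness asks for all iterated partial derivatives at once. A class of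
    functions that is closed under partial derivatives and consists of continuous
    functions settles all of them together; this one is generated by the
    operations needed below. The set O restricts where a base of a real power has
    to be positive, so that the weight |y|^a qualifies off {y = 0}. *)
Inductive smoothly_built (O : set 'rV[R]_d) : ('rV[R]_d -> R) -> Prop :=
| built_smooth f : smooth f -> smoothly_built O f
| built_cst (c : R) : smoothly_built O (fun=> c)
| built_coord i : smoothly_built O (fun z => z ord0 i)
| built_add f g : smoothly_built O f -> smoothly_built O g ->
    smoothly_built O (fun z => f z + g z)
| built_mul f g : smoothly_built O f -> smoothly_built O g ->
    smoothly_built O (fun z => f z * g z)
| built_flat k f : smoothly_built O f -> smoothly_built O (fun z => flat k (f z))
| built_powR (p : R) f : smoothly_built O f -> (forall z, O z -> 0 < f z) ->
    smoothly_built O (fun z => f z `^ p).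

Lemma smooth_pder f i : smooth f -> smooth (pder i f).
Proof.
move=> sf s; have := sf (rcons s i).
by rewrite /iter_pder foldr_rcons.
Qed.

Lemma is_derive_coord i j (z : 'rV[R]_d) :
  is_derive z (delta_mx ord0 i) (fun z : 'rV[R]_d => z ord0 j) (i == j)%:R.
Proof.
have E : (fun h : R => h^-1 *: (((fun z : 'rV[R]_d => z ord0 j) \o shift z)
   (h *: delta_mx ord0 i) - z ord0 j)) @ 0^' --> ((i == j)%:R : R).
  apply: (@cvg_trans _ (cst ((i == j)%:R : R) @ 0^')); last exact: cvg_cst.
  apply: near_eq_cvg; near=> h.
  have h0 : h != 0 by near: h; exact: nbhs_dnbhs_neq.
  rewrite /= !mxE eqxx /= addrK eq_sym.
  by rewrite /GRing.scale /= mulrA mulVf// mul1r.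
by split; [apply/cvg_ex; exists (i == j)%:R|exact: cvg_lim E].
Unshelve. all: by end_near. Qed.

Lemma continuous_row_coord i : continuous (fun z : 'rV[R]_d => z ord0 i).
Proof. by move=> z; exact: coord_continuous. Qed.

Lemma smoothly_built_continuous O f z : smoothly_built O f -> O z ->
  {for z, continuous f}.
Proof.
move=> + Oz; elim=> {f} [f sf|c|i|f g _ cf _ cg|f g _ cf _ cg|k f _ cf|p f _ cf f0].
- by have [+ _] := sf [::]; exact.
- exact: cst_continuous.
- exact: continuous_row_coord.
- exact: continuousD cf cg.
- exact: continuousM cf cg.
- by apply: (continuous_comp cf); exact: flat_continuous.
- apply: (@continuous_comp _ _ _ f (fun x => x `^ p)); first exact: cf.
  apply: differentiable_continuous; apply/derivable1_diffP.
  by case: (is_derive1_powR p (f0 z Oz)).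
Qed.

Lemma smoothly_built_is_derive O f i : smoothly_built O f ->
  exists2 g, smoothly_built O g &
    forall z, O z -> is_derive z (delta_mx ord0 i) f (g z).
Proof.
elim=> {f} [f sf|c|j|f g _ [f' bf Df] _ [g' bg Dg]|
  f g bf [f' bf' Df] bg [g' bg' Dg]|k f bf [f' bf' Df]|p f bf [f' bf' Df] f0].
- exists (pder i f); first by apply: built_smooth; exact: smooth_pder.
  by move=> z _; have [_ /(_ z i) /derivableP] := sf [::].
- by exists (fun=> 0); [exact: built_cst|move=> z _; exact: is_derive_cst].
- exists (fun=> (i == j)%:R); first exact: built_cst.
  by move=> z _; exact: is_derive_coord.
- exists (fun z => f' z + g' z); first exact: built_add.
  by move=> z Oz; apply: is_deriveD_fun; [exact: Df|exact: Dg].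
- exists (fun z => f z * g' z + f' z * g z).
    by apply: built_add; apply: built_mul.
  by move=> z Oz; apply: is_deriveM_fun; [exact: Df|exact: Dg].
- exists (fun z => (flat k.+2 (f z) + (- k%:R) * flat k.+1 (f z)) * f' z).
    apply: built_mul => //; apply: built_add; first exact: built_flat.
    by apply: built_mul; [exact: built_cst|exact: built_flat].
  move=> z Oz; rewrite mulNr; apply: is_derive_lcomp; last exact: Df.
  exact: flat_derive.
- exists (fun z => (p * f z `^ (p - 1)) * f' z).
    apply: built_mul => //; apply: built_mul; first exact: built_cst.
    exact: built_powR.
  move=> z Oz; apply: (is_derive_lcomp (F := fun x => x `^ p)); last exact: Df.
  exact/is_derive1_powR/f0.
Qed.

Lemma smoothly_built_smooth f : smoothly_built setT f -> smooth f.
Proof.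
move=> bf s; have bs : smoothly_built setT (iter_pder s f).
  elim: s => //= i s /(smoothly_built_is_derive i)[g bg Dg].
  rewrite (_ : pder i _ = g)//; apply/funext => z.
  exact: (derive_val (is_derive := Dg z I)).
split; first by move=> z; exact: smoothly_built_continuous bs _.
move=> z i; have [g _ Dg] := smoothly_built_is_derive i bs.
exact: (ex_derive (is_derive := Dg z I)).
Qed.

Lemma built_sum O (I : Type) (s : seq I) (P : pred I) (F : I -> 'rV[R]_d -> R) :
  (forall j, smoothly_built O (F j)) ->
  smoothly_built O (fun z => \sum_(j <- s | P j) F j z).
Proof.
move=> bF; elim: s => [|j s IHs].
  by under [X in smoothly_built _ X]eq_fun do rewrite big_nil; exact: built_cst.
under [X in smoothly_built _ X]eq_fun do rewrite big_cons.
by case: (P j) => //; apply: built_add.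
Qed.

Lemma built_sqr O f : smoothly_built O f -> smoothly_built O (fun z => f z ^+ 2).
Proof. by move=> bf; exact: built_mul. Qed.

End smooth_class.

(** * Borel sets of row vectors and integration of partial derivatives *)

Section borel_row.
Context {R : realType}.

Lemma measurable_row_box n (A : 'I_n -> set R) : (forall i, measurable (A i)) ->
  measurable [set x : 'rV[R]_n | forall i, A i (x ord0 i)].
Proof.
move=> mA; rewrite (_ : [set x | _] =
    \bigcap_(i in [set: 'I_n]) (row_coord i @^-1` A i)).
  apply: fin_bigcap_measurable => // i _.
  by rewrite -[X in measurable X]setTI; exact: measurable_row_coord.
by apply/seteqP; split=> x /= h i; [move=> _|]; exact: h.
Qed.

(** An open set is the union of the boxes with rational centres and radii
    1/(k+1) that it contains. *)
Lemma open_measurable_row n (A : set 'rV[R]_n) : open A -> measurable A.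
Proof.
move=> oA.
pose box (p : 'rV[rat]_n * nat) := [set z : 'rV[R]_n |
  forall i, ball (ratr (p.1 ord0 i) : R) (p.2.+1%:R^-1) (z ord0 i)].
have -> : A = \bigcup_p (if `[< box p `<=` A >] then box p else set0).
  apply/seteqP; split=> [z Az|z [p _]]; last by case: asboolP => // + pz; exact.
  have /nbhs_ballP[e /= e0 zeA] := open_nbhs_nbhs (conj oA Az).
  have e20 : 0 < e / 2 by rewrite divr_gt0.
  have [k _ /(_ k (leqnn k)) /= ke] := near_infty_natSinv_lt (PosNum e20).
  have k0 : 0 < k.+1%:R^-1 :> R by rewrite invr_gt0.
  have hq i : exists q : rat, ratr q \in `](z ord0 i - k.+1%:R^-1), (z ord0 i)[.
    by apply: rat_in_itvoo; rewrite ltrBlDr ltrDl.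
  pose q := \row_i (sval (cid (hq i))).
  have qz i : `|ratr (q ord0 i) - z ord0 i| < k.+1%:R^-1.
    rewrite mxE; case: (cid _) => r /=; rewrite in_itv/= => /andP[r1 r2].
    by rewrite ltr0_norm ?subr_lt0// opprB ltrBlDr -ltrBlDl.
  exists (q, k) => //; case: asboolP => [_ i|nb].
    exact: qz.
  exfalso; apply: nb => w bw; apply: zeA; split => // i j; rewrite (ord1 i) /ball /=.
  have := qz j; have := bw j; rewrite /ball/= => w1 w2.
  have -> : z ord0 j - w ord0 j = - (ratr (q ord0 j) - z ord0 j) + (ratr (q ord0 j) - w ord0 j).
    ring.
  apply: le_lt_trans (ler_normD _ _) _; rewrite normrN.
  by apply: lt_trans (ltrD w2 w1) _; rewrite [e]splitr ltrD.
apply: countable_bigcupT_measurable => [|p]; first exact: countableP.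
case: asboolP => // _; 
apply: (measurable_row_box (A := fun i => ball (ratr (p.1 ord0 i) : R) (p.2.+1%:R^-1))) => i.
apply: open_measurable; apply: ball_open; rewrite invr_gt0 ltr0n.
Qed.

Lemma open_continuous_measurable_row n (D : set 'rV[R]_n) (f : 'rV[R]_n -> R) :
  open D -> {in D, continuous f} -> measurable_fun D f.
Proof.
move=> oD cf; apply: (measurability _ (RGenOpens.measurableE R)).
move=> _ [_ [a [b ->] <-]]; apply: open_measurable_row.
have : open (`]a, b[%classic : set R) by exact: interval_open.
move: oD; rewrite !openE => oD oab z [Dz fz].
rewrite /interior; apply: filterI; first exact: oD.
by apply: cf; [exact: mem_set|exact: oab].
Qed.

Lemma continuous_measurable_row n (f : 'rV[R]_n -> R) :
  continuous f -> measurable_fun setT f.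
Proof.
move=> cf; apply: open_continuous_measurable_row; first exact: openT.
by move=> z _; exact: cf.
Qed.

Definition cube n (M : R) : set 'rV[R]_n := [set z | forall i, `[- M, M]%classic (z ord0 i)].
Arguments cube : clear implicits.

Lemma compact_cube n M : compact (cube n M).
Proof.
apply: bounded_closed_compact.
  exists `|M|; split; first exact: num_real.
  move=> r Mr z zM /=; rewrite [leLHS]mx_normrE.
  apply: bigmax_le => [|[i0 i] _] /=; first exact: le_trans (ltW Mr).
  rewrite (ord1 i0); have := zM i; rewrite /= in_itv /= => zi.
  apply: le_trans (ltW Mr); apply: le_trans (ler_norm M).
  by rewrite ler_norml.
rewrite (_ : cube n M = \bigcap_(i in [set: 'I_n])
    ((fun z : 'rV[R]_n => z ord0 i) @^-1` `[- M, M]%classic)).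
  apply: closed_bigI => i _; apply: closed_comp.
    by move=> z _; exact: continuous_row_coord.
  exact: interval_closed.
by apply/seteqP; split=> x /= h i; [move=> _|]; exact: h.
Qed.

Lemma measurable_cube n M : measurable (cube n M).
Proof.
by apply: (measurable_row_box (A := fun=> `[- M, M]%classic)) => i; exact: measurable_itv.
Qed.

Lemma lebesgue_row_cube n M : (lebesgue_row n (cube n M) < +oo)%E.
Proof.
rewrite (lebesgue_row_box (A := fun=> `[- M, M]%classic))// -ge0_fin_numE; last exact: prode_ge0.
apply: prode_fin_num => i _; rewrite lebesgue_measure_itv /=.
by case: ifP => // _; rewrite -EFinB.
Qed.


Lemma integrable_continuous_cube n (f : 'rV[R]_n -> R) M : continuous f ->
  (forall z, ~ cube n M z -> f z = 0) ->
  (lebesgue_row n).-integrable setT (EFin \o f).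
Proof.
move=> cf f0.
have -> : EFin \o f = (EFin \o f) \_ (cube n M).
  apply/funext => z; rewrite patchE; case: ifPn => // /negP zM /=.
  by rewrite f0// => /mem_set.
apply/(integrable_mkcond _ (@measurable_cube n M)).
apply: measurable_bounded_integrable; first exact: measurable_cube.
- exact: lebesgue_row_cube.
- exact: measurable_funTS (continuous_measurable_row cf).
- have := compact_bounded (continuous_compact (continuous_subspaceT cf) (@compact_cube n M)).
  move=> [N [Nr HN]]; exists N; split => // x Nx z Cz.
  by apply: (HN x Nx) => /=; exists z.
Qed.

Lemma continuous_row_consr n (t : R) : continuous (fun z : 'rV[R]_n => row_cons (t, z)).
Proof.
move=> z A /nbhs_ballP[e /= e0 eA]; apply/nbhs_ballP; exists e => //= w [_ zw].
apply: eA; split=> // i j; rewrite (ord1 i) !mxE.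
by case: unliftP => [k _|_] /=; [exact: zw|exact: ballxx].
Qed.

Lemma continuous_row_consl n (z : 'rV[R]_n) : continuous (fun t : R => row_cons (t, z)).
Proof.
move=> t A /nbhs_ballP[e /= e0 eA]; apply/nbhs_ballP; exists e => //= s ts.
apply: eA; split=> // i j; rewrite (ord1 i) !mxE.
by case: unliftP => [k _|_] /=; [exact: ballxx|exact: ts].
Qed.

Lemma integral_row_cons n (f : 'rV[R]_n.+1 -> R) :
  (lebesgue_row n.+1).-integrable setT (EFin \o f) ->
  ((\int[lebesgue_row n.+1]_z (f z)%:E =
    \int[lebesgue_measure \x lebesgue_row n]_p (f (row_cons p))%:E) /\
  (lebesgue_measure \x lebesgue_row n).-integrable setT
     (fun p => (f (row_cons p))%:E))%E.
Proof.
move=> fi; have mf : measurable_fun [set: 'rV[R]_n.+1] (EFin \o f) by case/integrableP : fi.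
have gi : (lebesgue_measure \x lebesgue_row n)%E.-integrable setT
    (fun p => (f (row_cons p))%:E).
  apply/integrableP; split.
    by apply: (measurableT_comp mf); exact: measurable_row_cons.
  case/integrableP : fi => _.
  rewrite /lebesgue_row /= /lebesgue_row_step ge0_integral_pushforward//=.
    exact: measurable_row_cons.
  exact: (measurableT_comp (@abse_measurable R setT) mf).
split=> //.
by rewrite /= /lebesgue_row_step integral_pushforward//; exact: measurable_row_cons.
Qed.

(** Fubini, with the coordinate i integrated first by the fundamental theorem of
    calculus. Lebesgue measure being built one coordinate at a time, the
    induction peels off coordinate 0 until i is reached. *)
Lemma integral_derivative_line n (i : 'I_n) (g dg : 'rV[R]_n -> R) (M : R) : 0 < M ->
  (forall z, is_derive z (delta_mx ord0 i) g (dg z)) -> continuous dg ->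
  (forall z : 'rV[R]_n, (exists j, M <= `|z ord0 j|) -> g z = 0 /\ dg z = 0) ->
  (\int[lebesgue_row n]_z (dg z)%:E = 0)%E.
Proof.
move=> M0; elim: n i g dg => [[]//|n IHn] i g dg Dg cdg g0.
have cub m (h : 'rV[R]_m -> R) : (forall z : 'rV[R]_m, (exists j, M <= `|z ord0 j|) -> h z = 0) ->
    forall z, ~ cube m M z -> h z = 0.
  move=> h0 z /existsNP[j zj]; apply: h0; exists j; rewrite leNgt; apply/negP.
  by move=> zM; apply: zj; rewrite /= in_itv /= -ler_norml ltW.
have [-> ig] := integral_row_cons (integrable_continuous_cube cdg
  (cub _ _ (fun z hz => (g0 z hz).2))).
case: (unliftP ord0 i) => [j ij|i0].
  rewrite -integral12_prod_meas1//; apply: integral0_eq => t _.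
  apply: (IHn j (fun z => g (row_cons (t, z)))) => [z||z [k zk]].
  - apply/is_derive_lineP.
    have /is_derive_lineP := Dg (row_cons (t, z)).
    apply: near_eq_is_derive; near=> h; congr g.
    apply/rowP => k; rewrite !mxE ij !eqxx/=.
    case: (unliftP ord0 k) => [l ->|->] /=; last by rewrite mulr0 add0r.
    by rewrite !mxE (inj_eq lift_inj).
  - by move=> z; apply: (continuous_comp (@continuous_row_consr n t z)); exact: cdg.
  - by apply: g0; exists (lift ord0 k); rewrite mxE liftK.
rewrite -integral21_prod_meas1//; apply: integral0_eq => z _.
rewrite /fubini_G /=.
have MM : - M < M by rewrite gtrN.
transitivity (\int[lebesgue_measure]_(t in `[(- M)%R, M]) (dg (row_cons (t, z)))%:E)%E.
  rewrite [RHS]integral_mkcond; apply: eq_integral => t _; rewrite patchE.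
  case: ifPn => // /negP tM; congr (_%:E); apply: (g0 _ _).2.
  exists ord0; rewrite mxE unlift_none /= leNgt; apply/negP => tM'; apply: tM.
  by apply/mem_set; rewrite /= in_itv /= -ler_norml ltW.
have D1 (t : R) : is_derive t 1 (fun t : R => g (row_cons (t, z))) (dg (row_cons (t, z))).
  apply/is_derive_lineP.
  have /is_derive_lineP := Dg (row_cons (t, z)).
  apply: near_eq_is_derive; near=> h; congr g.
  apply/rowP => k; rewrite !mxE i0 !eqxx/=.
  case: (unliftP ord0 k) => [l ->|->] /=; last by [].
  by rewrite mulr0 add0r.
have c1 : continuous (fun t : R => g (row_cons (t, z))).
  move=> t; apply: differentiable_continuous; apply/derivable1_diffP.
  by case: (D1 t).
rewrite (continuous_FTC2 (F := fun t : R => g (row_cons (t, z))) MM).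
- rewrite (g0 (row_cons (M, z)) _).1 ?(g0 (row_cons (- M, z)) _).1 ?subee//.
    by exists ord0; rewrite mxE unlift_none /= normrN ger0_norm// ltW.
  by exists ord0; rewrite mxE unlift_none /= ger0_norm// ltW.
- apply: continuous_subspaceT => t.
  by apply: (continuous_comp (@continuous_row_consl n z t)); exact: cdg.
- split; first by move=> t _; case: (D1 t).
  + exact/cvg_at_right_filter/c1.
  + exact/cvg_at_left_filter/c1.
- move=> t _; rewrite derive1E; exact: (derive_val (is_derive := D1 t)).
Unshelve. all: by end_near. Qed.

End borel_row.
Arguments cube {R} n M.

(** * The mass of the weight on cubes *)

Section weighted_cube.
Context {R : realType}.
Local Notation mu := (@lebesgue_measure R).

(** For al < 0 the integrand is unbounded at 0, so the fundamental theorem of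
    calculus is used away from 0 and the interval is exhausted. *)
Lemma integral_abs_powR (al rho : R) : -1 < al -> 0 < rho ->
  (\int[mu]_(t in `[(- rho)%R, rho]) (`|t| `^ al)%:E
    <= (2 / (1 + al) * rho `^ (1 + al))%:E)%E.
Proof.
move=> al1 rho0.
have al0 : 0 < 1 + al by rewrite -ltrBlDl sub0r.
pose f (t : R) := `|t| `^ al.
have mf : measurable_fun setT f.
  by apply: (measurableT_comp (f := fun x => x `^ al)) => //; exact: measurable_powR.
(* The cut-offs have to be smaller than rho from the start, hence k + 2. *)
pose e (k : nat) := rho / k.+2%:R.
have e0 k : 0 < e k by rewrite divr_gt0// ltr0n.
have er k : e k < rho by rewrite ltr_pdivrMr ?ltr0n// ltr_pMr// ltr1n.
pose F k : set R := `[(- rho), (- e k)] `|` `[e k, rho].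
have FE : `[- rho, rho]%classic = \bigcup_k F k `|` [set 0].
  apply/seteqP; split=> t /=.
    rewrite in_itv /= -ler_norml => tr.
    have [->|t0] := eqVneq t 0; [by right|left].
    have t0' : 0 < `|t| / rho by rewrite divr_gt0// normr_gt0.
    have [k _ /(_ k (leqnn k)) /= ke] := near_infty_natSinv_lt (PosNum t0').
    have ek : e k <= `|t|.
      rewrite /e ltW// ltr_pdivrMr ?ltr0n//.
      move: ke; rewrite ltr_pdivlMr// mulrC ltr_pdivrMr ?ltr0n// => ke.
      by apply: lt_le_trans ke _; rewrite ler_wpM2l ?ler_nat.
    exists k => //; rewrite /F /= !in_itv /=.
    have [tge|tlt] := ler0P t; [left|right].
      by move: tr ek; rewrite ler_norml => /andP[-> _]; rewrite ler0_norm// lerNr => ->.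
    by move: tr ek; rewrite ler_norml => /andP[_ ->]; rewrite gtr0_norm// andbT.
  have := ltW rho0; rewrite !in_itv /= => r0 [[k _]|->]; last by rewrite oppr_le0 r0.
  rewrite /F /= !in_itv /= => -[/andP[-> /= te]|/andP[te ->]].
    by apply: le_trans te _; apply: le_trans r0; rewrite oppr_le0 ltW.
  by rewrite andbT; apply: le_trans (le_trans (ltW (e0 k)) te); rewrite oppr_le0.
have mF k : measurable (F k) by apply: measurableU; exact: measurable_itv.
have f0 t : (0 <= (f t)%:E)%E by rewrite lee_fin powR_ge0.
have mfE D : measurable_fun D (EFin \o f).
  by apply: measurable_funTS; exact: measurableT_comp.
have part k : (\int[mu]_(t in `[e k, rho]) (f t)%:E <= ((1 + al)^-1 * rho `^ (1 + al))%:E)%E.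
  pose G (t : R) := (1 + al)^-1 * t `^ (1 + al).
  have DG (t : R) : 0 < t -> is_derive t 1 G (f t).
    move=> t0; rewrite /f gtr0_norm//.
    have := is_deriveM_fun (is_derive_cst ((1 + al)^-1) t 1) (is_derive1_powR (1 + al) t0).
    move=> /is_derive_eq; apply; rewrite /= mul0r addr0 mulrA mulVf ?lt0r_neq0// mul1r.
    by rewrite addrC addKr.
  have cG (t : R) : 0 < t -> {for t, continuous G}.
    by move=> /DG[? _]; apply: differentiable_continuous; exact/derivable1_diffP.
  have pos (t : R) : t \in `[e k, rho] -> 0 < t.
    by rewrite in_itv /= => /andP[+ _]; exact: lt_le_trans (e0 k).
  rewrite (continuous_FTC2 (F := G) (er k)).
  - by rewrite -EFinB lee_fin /G gerBl// mulr_ge0 ?powR_ge0// invr_ge0 ltW.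
  - apply: derivable_within_continuous => t /pos t0.
    apply: (near_eq_derivable (f := fun t : R => t `^ al)).
      by near=> s; rewrite /f gtr0_norm//; near: s; exact: lt_nbhsr.
    by case: (is_derive1_powR al t0).
  - split.
    + by move=> t /subset_itv_oo_cc/pos/DG[].
    + by apply: cvg_at_right_filter; apply: cG.
    + by apply: cvg_at_left_filter; apply: cG.
  - move=> t /subset_itv_oo_cc/pos/DG Dt; rewrite derive1E.
    exact: (derive_val (is_derive := Dt)).
have partF k : (\int[mu]_(t in F k) (f t)%:E <= (2 / (1 + al) * rho `^ (1 + al))%:E)%E.
  rewrite /F ge0_integral_setU//=; last first.
  - apply/disj_set2P/seteqP; split=> // t /=; rewrite !in_itv /= => -[/andP[_ t1] /andP[t2 _]].
    have := le_trans t2 t1; rewrite leNgt => /negP; apply.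
    by apply: lt_trans (e0 k); rewrite oppr_lt0.
  - exact: mfE.
  rewrite integration_by_substitution_oppr; last 2 first.
  - exact: ltW.
  - apply: derivable_within_continuous => t; rewrite in_itv /= => /andP[_ te].
    have t0 : t < 0 by apply: le_lt_trans te _; rewrite oppr_lt0.
    apply: (near_eq_derivable (f := fun t : R => (- t) `^ al)).
      by near=> s; rewrite /f ltr0_norm//; near: s; exact: lt_nbhsl.
    have t0' : 0 < - t by rewrite oppr_gt0.
    have Dm : is_derive t 1 (fun t : R => - t) (- 1) by apply: is_deriveN.
    by case: (is_derive_lcomp (f := fun t : R => - t) (is_derive1_powR al t0') Dm).
  under eq_integral do rewrite /= /f normrN -/(f _).
  apply: le_trans (leeD (part k) (part k)) _.
  by rewrite -EFinD lee_fin -mulrA mulr2n mulrDl mul1r.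
have nF : {homo F : n m / (n <= m)%N >-> (n <= m)%O}.
  apply/nondecreasing_seqP => k; apply/subsetPset => t.
  have ee : e k.+1 <= e k by rewrite /e ler_pM2l// lef_pV2 ?posrE ?ltr0n// ler_nat.
  rewrite /F /= !in_itv /= => -[/andP[-> t1]|/andP[t1 ->]]; [left|right].
    by rewrite (le_trans t1)// lerN2.
  by rewrite (le_trans ee).
rewrite FE ge0_integral_setU//=.
- rewrite integral_set1 ?adde0.
  have : (\int[mu]_(t in F k) (EFin \o f) t @[k --> \oo] -->
      \int[mu]_(t in \bigcup_k F k) (EFin \o f) t)%E.
    exact: (@ge0_nondecreasing_set_cvg_integral _ (measurableTypeR R) R F (EFin \o f)
      (@lebesgue_measure R) nF mF (fun k => mfE (F k)) (fun k t _ => f0 t)).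
  move=> cv; rewrite -(cvg_lim _ cv)//.
  apply: lime_le; first by apply/cvg_ex; eexists; exact: cv.
  by near=> k; exact: partF.
- exact: bigcupT_measurable.
- exact: mfE.
- apply/disj_set2P/seteqP; split=> // t /= [[k _]] + t0; rewrite t0 /F /= !in_itv /=.
  by rewrite oppr_ge0 !leNgt e0 /= andbF => -[].
Unshelve. all: by end_near. Qed.


Lemma integral_row_prod n (f : 'I_n -> R -> R) :
  (forall i, measurable_fun setT (f i)) -> (forall i t, 0 <= f i t) ->
  (\int[lebesgue_row n]_z (\prod_i f i (z ord0 i))%:E =
    \prod_i \int[mu]_t (f i t)%:E)%E.
Proof.
elim: n f => [|n IHn] f mf f0.
  rewrite big_ord0 /=; under eq_integral do rewrite big_ord0.
  by rewrite integral_dirac//= diracT mul1e.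
have mprod m (h : 'I_m -> R -> R) : (forall i, measurable_fun setT (h i)) ->
    measurable_fun setT (fun z : 'rV[R]_m => \prod_i h i (z ord0 i)).
  move=> mh; apply: measurable_prod => i _.
  exact: (measurableT_comp (mh i) (measurable_row_coord i)).
rewrite big_ord_recl -IHn//= /lebesgue_row_step ge0_integral_pushforward//=; last 3 first.
- exact: measurable_row_cons.
- by apply/measurable_EFinP; exact: (mprod _ f mf).
- by move=> z _; rewrite lee_fin prodr_ge0.
transitivity (\int[mu \x lebesgue_row n]_p ((f ord0 p.1)%:E *
   (\prod_i f (lift ord0 i) (p.2 ord0 i))%:E))%E.
  apply: eq_integral => -[t z] _ /=; rewrite -EFinM big_ord_recl; congr (_ * _)%:E.
    by rewrite !mxE unlift_none.
  by apply: eq_bigr => i _; rewrite !mxE liftK.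
rewrite fubini_tonelli1.
- rewrite /fubini_F /=.
  under eq_integral => t _.
    rewrite ge0_integralZl//=; last 3 first.
    - apply/measurable_EFinP.
      exact: (mprod n (fun i => f (lift ord0 i)) (fun i => mf _)).
    - by move=> z _; rewrite lee_fin prodr_ge0.
    - by rewrite lee_fin.
    over.
  rewrite ge0_integralZr//=.
  - by apply/measurable_EFinP; exact: (mf ord0).
  - by move=> t _; rewrite lee_fin.
  - by apply: integral_ge0 => z _; rewrite lee_fin prodr_ge0.
- apply: emeasurable_funM; apply/measurable_EFinP.
    exact: (measurableT_comp (mf ord0)).
  exact: (measurableT_comp (mprod n (fun i => f (lift ord0 i)) (fun i => mf _))).
- by move=> p; rewrite mule_ge0// lee_fin// prodr_ge0.
Qed.

Lemma sum_last_coords (V : nmodType) d n (x : V) : (n <= d)%N ->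
  \sum_(i < d | (d - n <= i)%N) x = x *+ n.
Proof.
move=> nd; rewrite -(big_geq_mkord (d - n) d xpredT (fun=> x)).
by rewrite big_const_nat subKn// iter_addr_0.
Qed.

Lemma continuous_ynorm d n : continuous (@ynorm R d n).
Proof.
move=> z; apply: (@continuous_comp _ _ _ _ (@Num.sqrt R)); last exact: sqrt_continuous.
apply: (@smoothly_built_continuous _ _ setT) => //; apply: built_sum => i.
exact/built_sqr/built_coord.
Qed.

Lemma continuous_enorm d : continuous (@enorm R d).
Proof.
move=> z; apply: (@continuous_comp _ _ _ (fun z : 'rV[R]_d => dotr z z) (@Num.sqrt R));
  last exact: sqrt_continuous.
apply: (@smoothly_built_continuous _ _ setT) => //; apply: built_sum => i.
by apply: built_mul; exact: built_coord.
Qed.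

Lemma measurable_weight d n (a : R) : measurable_fun setT (@weight R d n a).
Proof.
apply: (measurableT_comp (f := fun x => x `^ a)); first exact: measurable_powR.
by apply: continuous_measurable_row; exact: continuous_ynorm.
Qed.

Lemma coord_le_ynorm d n (z : 'rV[R]_d) (i : 'I_d) : (d - n <= i)%N ->
  `|z ord0 i| <= ynorm n z.
Proof.
move=> ni; rewrite -sqrtr_sqr ler_wsqrtr// (bigD1 i)//= lerDl.
by apply: sumr_ge0 => j _; exact: sqr_ge0.
Qed.

Lemma null_coord d (i : 'I_d) :
  lebesgue_row d [set z : 'rV[R]_d | z ord0 i = 0] = 0%E.
Proof.
pose A (j : 'I_d) : set R := if j == i then [set 0] else setT.
have -> : [set z : 'rV[R]_d | z ord0 i = 0] = [set z | forall j, A j (z ord0 j)].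
  apply/seteqP; split=> z /=.
    by move=> zi j; rewrite /A; case: eqP => // ->.
  by move=> /(_ i); rewrite /A eqxx.
rewrite lebesgue_row_box; last first.
  by move=> j; rewrite /A; case: eqP.
by rewrite (bigD1 i)//= /A eqxx lebesgue_measure_set1 mul0e.
Qed.

Lemma prod_powR (I : Type) (s : seq I) (P : pred I) (x : R) (e : I -> R) : 0 < x ->
  \prod_(i <- s | P i) x `^ e i = x `^ (\sum_(i <- s | P i) e i).
Proof.
move=> x0; rewrite (big_morph (fun y => x `^ y) (id1 := 1) (op1 := *%R))//.
  by move=> y z; rewrite powRD// lt0r_neq0// implybT.
exact: powRr0.
Qed.

(** As a <= 0 and |y| dominates every |y_i|, the factor |y|^(a/n) is at most
    |y_i|^(a/n); the product over the n coordinates of y separates variables with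
    exponents a/n, which exceed -1 as soon as a + n > 0. *)
Lemma weight_le_prod d n (a : R) (z : 'rV[R]_d) : (0 < n <= d)%N -> a <= 0 ->
  (forall i, z ord0 i != 0) ->
  weight n a z <= \prod_(i < d) `|z ord0 i| `^ (if (d - n <= i)%N then a / n%:R else 0).
Proof.
move=> /andP[n0 nd] a0 z0.
rewrite (eq_bigr (fun i : 'I_d => if (d - n <= i)%N then `|z ord0 i| `^ (a / n%:R) else 1));
  last first.
  by move=> i _; case: ifP => //; rewrite powRr0.
rewrite -big_mkcond /=.
have y0 : 0 < ynorm n z.
  have id : (d.-1 < d)%N by rewrite prednK// (leq_trans n0).
  apply: lt_le_trans (coord_le_ynorm (i := Ordinal id) z _); first by rewrite normr_gt0.
  by rewrite /= -subn1 leq_sub2l.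
have -> : weight n a z = \prod_(i < d | (d - n <= i)%N) ynorm n z `^ (a / n%:R).
  by rewrite prod_powR// sum_last_coords// -[a / _ *+ _]mulr_natr divfK// pnatr_eq0 -lt0n.
apply: ler_prod => i ni; rewrite powR_ge0 /=.
have e0 : 0 <= - (a / n%:R) by rewrite -mulNr divr_ge0// oppr_ge0.
have zi : 0 < `|z ord0 i| by rewrite normr_gt0.
rewrite -[a / _]opprK ![_ `^ (- - _)]powRN lef_pV2 ?posrE ?powR_gt0//.
by apply: ge0_ler_powR; rewrite ?nnegrE// ?coord_le_ynorm// ltW.
Qed.

Lemma integral_weight_cube d n (a : R) : (0 < n <= d)%N -> a <= 0 -> 0 < a + n%:R ->
  exists2 C : R, 0 <= C & forall rho, 0 < rho ->
  (\int[lebesgue_row d]_(z in cube d rho) (weight n a z)%:E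
     <= (C * rho `^ (d%:R + a))%:E)%E.
Proof.
move=> /andP[n0 nd] a0 an.
pose al (i : 'I_d) : R := if (d - n <= i)%N then a / n%:R else 0.
have n0' : 0 < n%:R :> R by rewrite ltr0n.
have al1 i : 0 < 1 + al i.
  rewrite /al; case: ifP => _; last by rewrite addr0.
  by rewrite -(pmulr_lgt0 _ n0') mulrDl mul1r divfK ?lt0r_neq0// addrC.
exists (\prod_i (2 / (1 + al i))) => [|rho rho0].
  by apply: prodr_ge0 => i _; rewrite divr_ge0// ltW.
pose f (i : 'I_d) (t : R) := \1_(`[- rho, rho]%classic) t * `|t| `^ al i.
have f0 i t : 0 <= f i t by rewrite mulr_ge0 ?powR_ge0.
have mf i : measurable_fun setT (f i).
  apply: measurable_funM; first by apply: measurable_indic; exact: measurable_itv.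
  by apply: (measurableT_comp (f := fun x => x `^ al i)) => //; exact: measurable_powR.
apply: (@le_trans _ _ (\int[lebesgue_row d]_z (\prod_i f i (z ord0 i))%:E)%E).
  rewrite integral_mkcond; apply: ae_ge0_le_integral => //.
  - by move=> z _; apply: erestrict_ge0 => ? _; rewrite lee_fin powR_ge0.
  - apply/(measurable_restrictT _ (@measurable_cube R d rho)).
    by apply/measurable_EFinP/measurable_funTS; exact: measurable_weight.
  - by move=> z _; rewrite lee_fin prodr_ge0.
  - apply/measurable_EFinP/measurable_prod => i _.
    exact: (measurableT_comp (mf i) (measurable_row_coord i)).
  (* On coordinate hyperplanes the convention 0 `^ x = 0 breaks the comparison. *)
  - have nz i : {ae lebesgue_row d, forall z : 'rV[R]_d, z ord0 i != 0}.
      exists [set z : 'rV[R]_d | z ord0 i = 0]; split.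
      + rewrite -[X in measurable X]setTI.
        exact: (measurable_row_coord i measurableT (measurable_set1 0)).
      + exact: null_coord.
      + by move=> z /= /negP; rewrite negbK => /eqP.
    have nz' := filter_forall (ae_filter_ringOfSetsType (lebesgue_row d)) nz.
    apply: filterS nz' => z z0 _.
    rewrite patchE; case: ifPn => [|_]; last by rewrite lee_fin prodr_ge0.
    rewrite inE => zc; rewrite lee_fin; apply: le_trans (weight_le_prod _ a0 z0) _.
      by rewrite n0 nd.
    apply: ler_prod => i _; rewrite powR_ge0 /f indicE.
    by have /mem_set -> := zc i; rewrite /= mul1r lexx.
rewrite (integral_row_prod mf f0).
apply: (@le_trans _ _ (\prod_i (2 / (1 + al i) * rho `^ (1 + al i)))%:E).
  rewrite -prodEFin.
  have bd i : (0 <= \int[mu]_t (f i t)%:E <= (2 / (1 + al i) * rho `^ (1 + al i))%:E)%E.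
    apply/andP; split; first by apply: integral_ge0 => t _; rewrite lee_fin.
    have al1' : -1 < al i by rewrite -subr_gt0 opprK addrC.
    apply: le_trans (integral_abs_powR al1' rho0).
    rewrite [leRHS]integral_mkcond le_eqVlt; apply/orP; left; apply/eqP.
    apply: eq_integral => t _; rewrite /f indicE patchE.
    by case: (t \in _); rewrite ?mul1r ?mul0r.
  suff : (0 <= \prod_i \int[mu]_t (f i t)%:E <=
    \prod_i (2 / (1 + al i) * rho `^ (1 + al i))%:E)%E by case/andP.
  elim/big_rec2 : _ => [|i y1 y2 _ /andP[y0 y12]]; first by rewrite lexx lee01.
  by have /andP[b0 b1] := bd i; rewrite mule_ge0//= lee_pmul.
rewrite lee_fin big_split/= prod_powR// [X in rho `^ X]big_split/=.
have -> : \sum_(i < d) (1 : R) = d%:R by rewrite sumr_const card_ord.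
rewrite -big_mkcond /= sum_last_coords//.
by rewrite -[a / _ *+ _]mulr_natr divfK ?lt0r_neq0.
Qed.

End weighted_cube.

(** * Partial derivatives of compactly supported functions on open sets *)

Section local_divergence.
Context {R : realType} (d : nat).

(** Extended by zero outside O, the function G stays differentiable in direction
    i with continuous derivative, because it vanishes off a compact subset of O. *)
Lemma integral_derivative_local (O K : set 'rV[R]_d) (i : 'I_d) (G D : 'rV[R]_d -> R) :
  open O -> compact K -> K `<=` O ->
  (forall z, O z -> is_derive z (delta_mx ord0 i) G (D z)) ->
  (forall z, O z -> {for z, continuous D}) ->
  (forall z, O z -> ~ K z -> G z = 0) ->
  (lebesgue_row d).-integrable O (EFin \o D) /\
  (\int[lebesgue_row d]_(z in O) (D z)%:E = 0)%E.
Proof.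
move=> oO cK KO DG cD G0.
have clK : closed K by apply: compact_closed => //; exact: norm_hausdorff.
have oK : open (~` K) by exact: closed_openC.
have nO z : O z -> \forall w \near z, O w by move=> Oz; exact: open_nbhs_nbhs.
have nK z : ~ K z -> \forall w \near z, ~ K w by move=> Kz; exact: open_nbhs_nbhs.
pose g := G \_ O; pose dg := D \_ O.
have gE z : O z -> g z = G z by move=> Oz; rewrite /g patchE mem_set.
have dgE z : O z -> dg z = D z by move=> Oz; rewrite /dg patchE mem_set.
have gK z : ~ K z -> g z = 0.
  by move=> Kz; rewrite /g patchE; case: ifPn => //; rewrite inE => Oz; exact: G0.
have dgK z : ~ K z -> dg z = 0.
  move=> Kz; rewrite /dg patchE; case: ifPn => //; rewrite inE => Oz.
  have [_ <-] := DG z Oz; rewrite (@near_eq_derive _ _ _ G (cst 0)) ?derive_cst//.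
  near=> w; apply: G0; first by near: w; exact: nO.
  by near: w; exact: nK.
have mO : measurable O by exact: open_measurable_row.
have Dg z : is_derive z (delta_mx ord0 i) g (dg z).
  have [Kz|Kz] := pselect (K z).
    have Oz := KO _ Kz; rewrite dgE//; apply: near_eq_is_derive (DG z Oz).
    by near=> w; rewrite gE//; near: w; exact: nO.
  rewrite dgK//; apply: (near_eq_is_derive (f := cst 0)).
  by near=> w; rewrite gK//; near: w; exact: nK.
have cdg : continuous dg.
  move=> z; have [Kz|Kz] := pselect (K z).
    have Oz := KO _ Kz; rewrite /continuous_at dgE//.
    have E : {near z, D =1 dg} by near=> w; rewrite dgE//; near: w; exact: nO.
    exact: cvg_trans (near_eq_cvg E) (cD z Oz).
  have E : {near z, cst 0 =1 dg} by near=> w; rewrite dgK//; near: w; exact: nK.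
  rewrite /continuous_at dgK//; exact: cvg_trans (near_eq_cvg E) (cvg_cst (0 : R)).
have [M0 [M0r KM]] := compact_bounded cK.
pose M : R := `|M0| + 1.
have M1 : M0 < M by rewrite ltr_pwDr// ler_norm.
have Mpos : 0 < M + 1 by rewrite addr_gt0// ltr_wpDl.
have outM (z : 'rV[R]_d) : (exists j, M + 1 <= `|z ord0 j|) -> ~ K z.
  move=> [j zj] /(KM M M1) /=; rewrite [leLHS]mx_normrE => zM.
  have : `|z ord0 j| <= M.
    by apply: le_trans zM; apply: (le_bigmax _ (fun ij => `|z ij.1 ij.2|) (ord0, j)).
  by move=> /(le_trans zj); rewrite gerDl ler10.
have EE : (EFin \o D) \_ O = EFin \o dg.
  by apply/funext => z; rewrite /dg /= !patchE; case: ifP.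
split.
  apply/(integrable_mkcond _ mO); rewrite EE.
  apply: (@integrable_continuous_cube _ _ _ (M + 1)) => // z zM; apply: dgK => Kz; apply: zM => j.
  rewrite /= in_itv /= -ler_norml leNgt; apply/negP => /ltW zj.
  by apply: (outM z) => //; exists j.
rewrite integral_mkcond EE; apply: (integral_derivative_line Mpos Dg cdg) => z /outM Kz.
by rewrite gK// dgK.
Unshelve. all: by end_near. Qed.

End local_divergence.

(** * Quadratic forms and the inverse of the y-block *)

Section quadratic_forms.
Context {R : realType} (d : nat).
Implicit Types (v w z : 'rV[R]_d) (M : 'M[R]_d).

Lemma dotrE v w : dotr v w = (v *m w^T) ord0 ord0.
Proof. by rewrite mxE; apply: eq_bigr => i _; rewrite mxE. Qed.

Lemma dotr_mxl v w M : dotr (v *m M) w = dotr v (w *m M^T).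
Proof. by rewrite !dotrE trmx_mul trmxK mulmxA. Qed.

Lemma dotr_mxr v w M : dotr v (w *m M) = dotr (v *m M^T) w.
Proof. by rewrite dotr_mxl trmxK. Qed.

Lemma dotrC v w : dotr v w = dotr w v.
Proof. by apply: eq_bigr => i _; rewrite mulrC. Qed.

Lemma dotrDl v1 v2 w : dotr (v1 + v2) w = dotr v1 w + dotr v2 w.
Proof. by rewrite !dotrE mulmxDl mxE. Qed.

Lemma dotrZl (k : R) v w : dotr (k *: v) w = k * dotr v w.
Proof. by rewrite !dotrE -scalemxAl mxE. Qed.

Lemma dotrDr v w1 w2 : dotr v (w1 + w2) = dotr v w1 + dotr v w2.
Proof. by rewrite dotrC dotrDl !(dotrC v). Qed.

Lemma dotrZr (k : R) v w : dotr v (k *: w) = k * dotr v w.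
Proof. by rewrite dotrC dotrZl dotrC. Qed.

Lemma dotrNl v w : dotr (- v) w = - dotr v w.
Proof. by rewrite -scaleN1r dotrZl mulN1r. Qed.

Lemma dotrNr v w : dotr v (- w) = - dotr v w.
Proof. by rewrite dotrC dotrNl dotrC. Qed.

Lemma dotr_ge0 v : 0 <= dotr v v.
Proof. by apply: sumr_ge0 => i _; rewrite -expr2 sqr_ge0. Qed.

Lemma dotr_eq0 v : (dotr v v == 0) = (v == 0).
Proof.
apply/eqP/eqP => [|->]; last by rewrite dotrE mul0mx mxE.
move=> v0; apply/rowP => i; rewrite mxE; apply/eqP; rewrite -sqrf_eq0 expr2.
move/eqP: v0; rewrite /dotr psumr_eq0; last by move=> j _; rewrite -expr2 sqr_ge0.
by move/allP => /(_ i (mem_index_enum i)).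
Qed.

Lemma enorm_sqr v : enorm v ^+ 2 = dotr v v.
Proof. by rewrite sqr_sqrtr// dotr_ge0. Qed.

Lemma enorm_ge0 v : 0 <= enorm v.
Proof. exact: sqrtr_ge0. Qed.

Lemma dotr0l v : dotr 0 v = 0.
Proof. by rewrite dotrE mul0mx mxE. Qed.

Lemma built_linear (O : set 'rV[R]_d) M (j : 'I_d) :
  smoothly_built O (fun z => (z *m M) ord0 j).
Proof.
under [X in smoothly_built _ X]eq_fun do rewrite mxE.
by apply: built_sum => k; apply: built_mul; [exact: built_coord|exact: built_cst].
Qed.

Lemma built_quadratic (O : set 'rV[R]_d) M :
  smoothly_built O (fun z => dotr z (z *m M)).
Proof.
by apply: built_sum => i; apply: built_mul; [exact: built_coord|exact: built_linear].
Qed.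

Lemma continuous_dotr_mx M : continuous (fun z => dotr z (z *m M)).
Proof. by move=> z; exact: (smoothly_built_continuous (built_quadratic setT M)). Qed.

Lemma is_derive_sum_fun (I : Type) (s : seq I) (F : I -> 'rV[R]_d -> R) (dF : I -> R) z v :
  (forall i, is_derive z v (F i) (dF i)) ->
  is_derive z v (fun z => \sum_(i <- s) F i z) (\sum_(i <- s) dF i).
Proof.
move=> DF; elim: s => [|i s IHs].
  rewrite big_nil; under [X in is_derive _ _ X]eq_fun do rewrite big_nil.
  exact: is_derive_cst.
rewrite big_cons; under [X in is_derive _ _ X]eq_fun do rewrite big_cons.
exact: is_deriveD_fun.
Qed.

Lemma is_derive_linear M (i j : 'I_d) z :
  is_derive z (delta_mx ord0 i) (fun z => (z *m M) ord0 j) (M i j).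
Proof.
under [X in is_derive _ _ X]eq_fun do rewrite mxE.
have := is_derive_sum_fun (index_enum 'I_d) (fun k => is_deriveM_fun (is_derive_coord i k z)
   (is_derive_cst (M k j) z (delta_mx ord0 i))).
move=> /is_derive_eq; apply; rewrite (bigD1 i)//= eqxx mul1r mulr0 add0r big1 ?addr0//.
by move=> k /negbTE ki; rewrite eq_sym ki mul0r mulr0 addr0.
Qed.

Lemma is_derive_quadratic M (i : 'I_d) z : M^T = M ->
  is_derive z (delta_mx ord0 i) (fun z => dotr z (z *m M)) (2 * (z *m M) ord0 i).
Proof.
move=> Ms; have := is_derive_sum_fun (index_enum 'I_d) (fun k =>
  is_deriveM_fun (is_derive_coord i k z) (is_derive_linear M i k z)).
move=> /is_derive_eq; apply; rewrite big_split /= mulr_natl mulr2n; congr (_ + _).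
  by rewrite mxE; apply: eq_bigr => k _; rewrite -[in LHS]Ms mxE.
rewrite (bigD1 i)//= eqxx mul1r big1 ?addr0// => k /negbTE ki.
by rewrite eq_sym ki mul0r.
Qed.

Definition projy n : 'M[R]_d := diag_mx (\row_i (d - n <= i)%N%:R).

Lemma projy_row n z i : (z *m projy n) ord0 i = if (d - n <= i)%N then z ord0 i else 0.
Proof.
rewrite mxE (bigD1 i)//= !mxE eqxx mulr1n big1 ?addr0.
  by case: ifP => _; rewrite ?mulr1 ?mulr0.
by move=> k ki; rewrite !mxE (negbTE ki) mulr0n mulr0.
Qed.

Lemma projy_tr n : (projy n)^T = projy n.
Proof. exact: tr_diag_mx. Qed.

Lemma projy_idem n : projy n *m projy n = projy n.
Proof.
rewrite /projy mulmx_diag; congr diag_mx; apply/rowP => i; rewrite !mxE.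
by case: leqP => _; rewrite ?mulr1 ?mulr0.
Qed.

Lemma ynorm_sqr n z : dotr z (z *m projy n) = ynorm n z ^+ 2.
Proof.
rewrite sqr_sqrtr; last by apply: sumr_ge0 => i _; rewrite sqr_ge0.
rewrite [RHS]big_mkcond; apply: eq_bigr => i _; rewrite projy_row.
by case: ifP => _; rewrite ?mulr0.
Qed.

Lemma projy_trace n : (n <= d)%N -> \tr (projy n) = n%:R.
Proof.
move=> nd; rewrite mxtrace_diag; under eq_bigr do rewrite mxE.
rewrite -(sum_last_coords (1 : R) nd) [RHS]big_mkcond.
by apply: eq_bigr => i _; case: ifP.
Qed.

Section elliptic.
Context (A : 'M[R]_d) (lam : R).
Hypotheses (A_sym : A^T = A) (lam0 : 0 < lam)
  (A_lower : forall xi, lam * enorm xi ^+ 2 <= dotr (mxact A xi) xi).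

Lemma mxactE v : mxact A v = v *m A. Proof. by rewrite /mxact A_sym. Qed.

Lemma elliptic_ge0 v : 0 <= dotr v (v *m A).
Proof.
rewrite dotrC -mxactE; apply: le_trans (A_lower v).
by rewrite mulr_ge0 ?sqr_ge0// ltW.
Qed.

Lemma elliptic_definite v : dotr v (v *m A) = 0 -> v = 0.
Proof.
move=> vA; have := A_lower v; rewrite mxactE dotrC vA enorm_sqr => h.
apply/eqP; rewrite -dotr_eq0 eq_le dotr_ge0 andbT.
by rewrite -(pmulr_rle0 _ lam0).
Qed.

Lemma elliptic_unit : A \in unitmx.
Proof.
rewrite -row_free_unit; apply/inj_row_free => v vA0.
by apply: elliptic_definite; rewrite vA0 dotrC dotr0l.
Qed.

Lemma invmx_sym : (invmx A)^T = invmx A.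
Proof. by rewrite trmx_inv A_sym. Qed.

(** C is the inverse of the y-block of A, extended by zero. To avoid block
    decompositions it is read off from the definite matrix Y A Y + (1 - Y), which
    commutes with the projection Y. *)
Lemma pseudo_inverse n : exists C : 'M[R]_d,
  [/\ C^T = C, projy n *m C = C, projy n *m A *m C = projy n & C *m A *m C = C].
Proof.
pose Y := projy n; pose M := Y *m A *m Y + (1%:M - Y).
have YY : Y *m Y = Y by exact: projy_idem.
have YC : Y *m (1%:M - Y) = 0 by rewrite mulmxBr mulmx1 YY subrr.
have CY : (1%:M - Y) *m Y = 0 by rewrite mulmxBl mul1mx YY subrr.
have Mu : M \in unitmx.
  rewrite -row_free_unit; apply/inj_row_free => v vM0.
  have h1 : v *m Y = 0.
    apply: elliptic_definite.
    have : dotr (v *m M) (v *m Y) = 0 by rewrite vM0 dotr0l.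
    have -> : dotr (v *m M) (v *m Y) = dotr (v *m Y *m A *m Y) (v *m Y)
        + dotr (v *m (1%:M - Y)) (v *m Y).
      by rewrite -dotrDl /M mulmxDr !mulmxA.
    rewrite [X in _ + X]dotrC [X in _ + X]dotr_mxl {3}/Y projy_tr -/Y -[v *m _ *m Y]mulmxA CY.
    rewrite mulmx0 [X in _ + X]dotrC dotr0l addr0 dotr_mxl {2}/Y projy_tr -/Y.
    by rewrite -[v *m Y *m Y]mulmxA YY dotrC.
  have := vM0; rewrite /M mulmxDr !mulmxA h1 !mul0mx add0r mulmxBr mulmx1 h1 subr0.
  exact.
have MY : M *m Y = Y *m A *m Y by rewrite mulmxDl CY addr0 -mulmxA YY.
have YM : Y *m M = Y *m A *m Y by rewrite mulmxDr YC addr0 !mulmxA YY.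
have cY : invmx M *m Y = Y *m invmx M.
  rewrite -[LHS]mulmx1 -(mulmxV Mu) mulmxA -[invmx M *m Y *m M]mulmxA YM -MY.
  by rewrite [invmx M *m _]mulmxA mulVmx// mul1mx.
have Ms : M^T = M.
  by rewrite /M linearD linearB /= !trmx_mul trmx1 /Y projy_tr A_sym !mulmxA.
have CE : Y *m (invmx M *m Y) = invmx M *m Y by rewrite {1}cY mulmxA YY.
have YAC : Y *m A *m (invmx M *m Y) = Y.
  by rewrite -CE !mulmxA -YM -[Y *m M *m _]mulmxA mulmxV// mulmx1 YY.
exists (invmx M *m Y); split=> //.
- by rewrite trmx_mul trmx_inv Ms /Y projy_tr.
- by have := congr1 (mulmx (invmx M)) YAC; rewrite !mulmxA.
Qed.

End elliptic.
End quadratic_forms.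

(** * A Hardy-type inequality *)

Section hardy_field.
Context {R : realType} (d n : nat) (a lam : R) (A C : 'M[R]_d).
Hypotheses (nd : (n <= d)%N) (A_sym : A^T = A) (lam0 : 0 < lam)
  (A_lower : forall xi, lam * enorm xi ^+ 2 <= dotr (mxact A xi) xi)
  (C_sym : C^T = C) (YC : @projy R d n *m C = C) (YAC : @projy R d n *m A *m C = @projy R d n)
  (CAC : C *m A *m C = C).
Implicit Types (z v w : 'rV[R]_d).

Local Notation Y := (@projy R d n).
Local Notation sigma := (2 - a - n%:R).
Let Au := elliptic_unit A_sym lam0 A_lower.

Definition ysq z := dotr z (z *m Y).
Definition qC z := dotr z (z *m C).
Definition qA z := dotr z (z *m invmx A).

Lemma weight_powR z : weight n a z = ysq z `^ (a / 2).
Proof.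
rewrite /weight /ysq ynorm_sqr -powR_mulrn ?sqrtr_ge0// -powRrM.
by rewrite mulrC divfK// pnatr_eq0.
Qed.

Lemma dotr_projy_CA z : dotr (z *m Y) (z *m C *m A) = ysq z.
Proof.
rewrite !dotr_mxr C_sym A_sym [RHS]dotrC; congr dotr.
by rewrite -[in RHS]YAC !mulmxA.
Qed.

Lemma dotr_C_CA z : dotr (z *m C) (z *m C *m A) = qC z.
Proof. by rewrite !dotr_mxr C_sym A_sym [RHS]dotrC -[in RHS]CAC !mulmxA. Qed.

Lemma dotr_projy z : dotr (z *m Y) z = ysq z.
Proof. exact: dotrC. Qed.

Lemma dotr_inv_CA z : dotr (z *m invmx A) (z *m C *m A) = qC z.
Proof. by rewrite !dotr_mxr C_sym A_sym [RHS]dotrC mulmxKV. Qed.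

Lemma qC_gt0 z : 0 < ysq z -> 0 < qC z.
Proof.
move=> s0; rewrite lt_neqAle -dotr_C_CA (elliptic_ge0 A_sym lam0 A_lower) andbT eq_sym.
apply/eqP => /(elliptic_definite A_sym lam0 A_lower) zC0.
by move: s0; rewrite -dotr_projy_CA zC0 mul0mx dotrC dotr0l ltxx.
Qed.

Lemma trace_CA : \tr (C *m A) = n%:R.
Proof.
rewrite -(@projy_trace R _ _ nd) -YAC -[RHS]mxtrace_tr !trmx_mul C_sym A_sym projy_tr.
by rewrite mulmxA [RHS]mxtrace_mulC mulmxA YC.
Qed.

Lemma is_derive_powRN1 (x : R) : 0 < x ->
  is_derive x 1 (fun y => y `^ (- 1)) (- (x^-1 ^+ 2)).
Proof.
move=> x0; apply: (is_derive_eq (is_derive1_powR (- 1) x0)).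
have -> : -1 - 1 = - (2%:R) :> R by ring.
by rewrite mulN1r powRN powR_mulrn ?ltW// exprVn.
Qed.

Section profile.
Variables F0 F1 F2 : R -> R.

(** The components of w f^2 (rho A g + F0'(P) z), where rho = F0(P) and
    g = sigma C z / q is the logarithmic gradient of q^(sigma/2). Inverses are
    written as real powers to remain within smoothly_built. *)
Definition hardy_field (f : 'rV[R]_d -> R) (i : 'I_d) z : R :=
  ysq z `^ (a / 2) * (f z * f z) *
  (F0 (qA z) * (sigma * qC z `^ (- 1)) * (z *m (C *m A)) ord0 i + F1 (qA z) * z ord0 i).

Definition hardy_coef z (i : 'I_d) : R :=
  F0 (qA z) * (sigma / qC z) * (z *m (C *m A)) ord0 i + F1 (qA z) * z ord0 i.

(** The i-th partial derivative of hardy_field f i, with phi standing for the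
    gradient of f at z. *)
Definition hardy_div (f : 'rV[R]_d -> R) (phi : 'rV[R]_d) (i : 'I_d) z : R :=
  ysq z `^ (a / 2) *
  (a / ysq z * (z *m Y) ord0 i * (f z * f z) * hardy_coef z i
   + 2 * f z * phi ord0 i * hardy_coef z i
   + f z * f z *
     (2 * F1 (qA z) * (z *m invmx A) ord0 i * (sigma / qC z) * (z *m (C *m A)) ord0 i
      - 2 * F0 (qA z) * (sigma / qC z ^+ 2) * (z *m C) ord0 i * (z *m (C *m A)) ord0 i
      + F0 (qA z) * (sigma / qC z) * (C *m A) i i
      + 2 * F2 (qA z) * (z *m invmx A) ord0 i * z ord0 i
      + F1 (qA z))).

Lemma is_derive_hardy_field f (phi : 'rV[R]_d) i z : 0 < ysq z ->
  is_derive z (delta_mx ord0 i) f (phi ord0 i) ->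
  is_derive (qA z) 1 F0 (F1 (qA z)) -> is_derive (qA z) 1 F1 (F2 (qA z)) ->
  is_derive z (delta_mx ord0 i) (hardy_field f i) (hardy_div f phi i z).
Proof.
move=> s0 Df DF0 DF1; have q0 := qC_gt0 s0.
have Ds := is_derive_lcomp (is_derive1_powR (a / 2) s0) (is_derive_quadratic i z (@projy_tr R d n)).
have Dq := is_derive_lcomp (is_derive_powRN1 q0) (is_derive_quadratic i z C_sym).
have DP := is_derive_quadratic i z (invmx_sym A_sym).
have D0 := is_derive_lcomp DF0 DP.
have D1 := is_derive_lcomp DF1 DP.
have Dx := is_derive_linear (C *m A) i i z.
have Dz := is_derive_coord i i z.
have Dc := is_derive_cst sigma z (delta_mx ord0 i).
have D := is_deriveM_fun (is_deriveM_fun Ds (is_deriveM_fun Df Df))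
  (is_deriveD_fun (is_deriveM_fun (is_deriveM_fun D0 (is_deriveM_fun Dc Dq)) Dx)
     (is_deriveM_fun D1 Dz)).
apply: (is_derive_eq D).
rewrite /hardy_div /hardy_coef eqxx.
have -> : dotr z (z *m Y) `^ (a / 2 - 1) = ysq z `^ (a / 2) / ysq z.
  by rewrite powRD ?powR_inv1 ?ltW// lt0r_neq0// implybT.
rewrite -/(ysq z) -/(qA z) -/(qC z) powR_inv1 ?(ltW q0)//=.
by field; rewrite !lt0r_neq0.
Qed.

(** The contractions y . A C z = |y|^2, C z . A C z = q and A^-1 z . A C z = q
    together with tr (C A) = n collapse the divergence; n and a enter the
    coefficient of 1/q only through a + n - 2 = - sigma. *)
Lemma sum_hardy_div f (phi : 'rV[R]_d) z : 0 < ysq z ->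
  \sum_i hardy_div f phi i z = ysq z `^ (a / 2) *
   (2 * f z * (F0 (qA z) * (sigma / qC z) * dotr phi (z *m C *m A) + F1 (qA z) * dotr phi z)
    - f z ^+ 2 * (F0 (qA z) * sigma ^+ 2 / qC z)
    + f z ^+ 2 * ((a + d%:R + 2 * sigma) * F1 (qA z) + 2 * qA z * F2 (qA z))).
Proof.
move=> s0; have q0 := qC_gt0 s0.
pose k := F0 (qA z) * (sigma / qC z).
pose x := z *m (C *m A); pose y := z *m Y; pose p := z *m invmx A; pose g := z *m C.
transitivity (ysq z `^ (a / 2) *
  (a / ysq z * f z ^+ 2 * (k * dotr y x + F1 (qA z) * dotr y z)
   + 2 * f z * (k * dotr phi x + F1 (qA z) * dotr phi z)
   + f z ^+ 2 * (2 * F1 (qA z) * (sigma / qC z) * dotr p x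
      - 2 * F0 (qA z) * (sigma / qC z ^+ 2) * dotr g x
      + k * \tr (C *m A) + 2 * F2 (qA z) * dotr p z + d%:R * F1 (qA z)))).
  pose c := a / ysq z * f z ^+ 2.
  transitivity (\sum_i ysq z `^ (a / 2) *
    (c * k * (y ord0 i * x ord0 i) + c * F1 (qA z) * (y ord0 i * z ord0 i)
     + 2 * f z * k * (phi ord0 i * x ord0 i)
     + 2 * f z * F1 (qA z) * (phi ord0 i * z ord0 i)
     + f z ^+ 2 * (2 * F1 (qA z) * (sigma / qC z)) * (p ord0 i * x ord0 i)
     - f z ^+ 2 * (2 * F0 (qA z) * (sigma / qC z ^+ 2)) * (g ord0 i * x ord0 i)
     + f z ^+ 2 * k * (C *m A) i i
     + f z ^+ 2 * (2 * F2 (qA z)) * (p ord0 i * z ord0 i)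
     + f z ^+ 2 * F1 (qA z))).
    by apply: eq_bigr => i _; rewrite /hardy_div /hardy_coef -/k -/x -/y -/p -/g /c; ring.
  rewrite -mulr_sumr; congr (_ * _).
  rewrite !big_split /= sumrN -!mulr_sumr sumr_const card_ord -/(\tr _).
  rewrite -!/(dotr _ _) -[F1 _ *+ d]mulr_natr /c.
  ring.
rewrite /x mulmxA dotr_projy_CA dotr_inv_CA dotr_C_CA dotr_projy trace_CA.
rewrite [dotr p z]dotrC -/(qA z) /k.
by field; rewrite !lt0r_neq0.
Qed.

(** After the divergence is subtracted, the difference of the two sides is
    w F0(P) A (phi - kap C z) . (phi - kap C z) with kap = f sigma / q. *)
Lemma hardy_pointwise f (phi : 'rV[R]_d) z : 0 < ysq z -> 0 <= F0 (qA z) ->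
  ysq z `^ (a / 2) * f z ^+ 2 *
    (- (a + d%:R + 2 * sigma) * F1 (qA z) - 2 * qA z * F2 (qA z)) <=
  ysq z `^ (a / 2) *
    dotr (mxact A phi) (F0 (qA z) *: phi + (f z * (2 * F1 (qA z))) *: (z *m invmx A))
  - \sum_i hardy_div f phi i z.
Proof.
move=> s0 F0ge; have q0 := qC_gt0 s0.
rewrite sum_hardy_div// -subr_ge0.
pose kap := f z * sigma / qC z.
have e := elliptic_ge0 A_sym lam0 A_lower (phi - kap *: (z *m C)).
have E : dotr (phi - kap *: (z *m C)) ((phi - kap *: (z *m C)) *m A) =
  dotr (mxact A phi) phi - 2 * kap * dotr phi (z *m C *m A) + kap ^+ 2 * qC z.
  rewrite -(dotr_C_CA z) mxactE// mulmxDl mulNmx -scalemxAl.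
  rewrite !(dotrDl, dotrDr, dotrNl, dotrNr, dotrZl, dotrZr).
  rewrite (dotrC (phi *m A)) (dotr_mxr (z *m C) phi A) A_sym (dotrC (z *m C *m A)).
  ring.
rewrite E in e.
rewrite dotrDr !dotrZr.
have -> : dotr (mxact A phi) (z *m invmx A) = dotr phi z.
  by rewrite mxactE// dotr_mxr (invmx_sym A_sym) mulmxK.
have w0 := powR_ge0 (ysq z) (a / 2).
apply: le_trans (mulr_ge0 w0 (mulr_ge0 F0ge e)) _.
rewrite le_eqVlt; apply/orP; left; apply/eqP; rewrite /kap.
by field; rewrite !lt0r_neq0.
Qed.

End profile.
End hardy_field.

(** * The weighted energy space *)

Section real_integrable.
Context {R : realType} (d : nat) (O : set 'rV[R]_d).
Hypothesis mO : measurable O.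
Local Notation mu := (lebesgue_row d).
Implicit Types f g : 'rV[R]_d -> R.

Definition rintegrable f := mu.-integrable O (EFin \o f).

Lemma rintegrableD f g : rintegrable f -> rintegrable g ->
  rintegrable (fun z => f z + g z).
Proof. by move=> fi gi; exact: (integrableD mO fi gi). Qed.

Lemma rintegrableZ (k : R) f : rintegrable f -> rintegrable (fun z => k * f z).
Proof. by move=> fi; exact: (integrableZl mO k fi). Qed.

Lemma rintegrableB f g : rintegrable f -> rintegrable g ->
  rintegrable (fun z => f z - g z).
Proof. by move=> fi gi; exact: (integrableB mO fi gi). Qed.

Lemma rintegrable_le f g : measurable_fun O f -> (forall z, O z -> `|f z| <= g z) ->
  rintegrable g -> rintegrable f.
Proof.
move=> mf fg; apply: le_integrable => //; first exact/measurable_EFinP.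
move=> z Oz /=; rewrite lee_fin; apply: le_trans (fg z Oz) _; exact: ler_norm.
Qed.

Lemma rintegrable_sum (I : Type) (s : seq I) (F : I -> 'rV[R]_d -> R) :
  (forall i, rintegrable (F i)) -> rintegrable (fun z => \sum_(i <- s) F i z) /\
  \int[mu]_(z in O) (\sum_(i <- s) F i z) = \sum_(i <- s) \int[mu]_(z in O) F i z.
Proof.
move=> Fi; elim: s => [|i s [IH1 IH2]].
  rewrite (_ : (fun z => _) = cst 0); last by apply/funext => z; rewrite big_nil.
  by rewrite big_nil /Rintegral integral0; split=> //; exact: integrable0.
rewrite (_ : (fun z => _) = (fun z => F i z + \sum_(i <- s) F i z)); last first.
  by apply/funext => z; rewrite big_cons.
split; first exact: rintegrableD.
by rewrite (RintegralD mO (Fi i) IH1) big_cons -IH2.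
Qed.

Lemma ge0_rintegrable f : measurable_fun O f -> (forall z, O z -> 0 <= f z) ->
  (\int[mu]_(z in O) (f z)%:E < +oo)%E -> rintegrable f.
Proof.
move=> mf f0 foo; apply/integrableP; split; first exact/measurable_EFinP.
apply: le_lt_trans foo; rewrite le_eqVlt; apply/orP; left; apply/eqP.
by apply: eq_integral => z; rewrite inE => Oz /=; rewrite ger0_norm// f0.
Qed.

End real_integrable.

Section compact_support.
Context {R : realType} (d n : nat) (a eps r : R).
Hypothesis eps0 : 0 <= eps.
Local Notation mu := (lebesgue_row d).

Definition shell : set 'rV[R]_d := eball r `\` Sigma n eps.

Lemma shell_open : open shell.
Proof.
rewrite /shell setDE; apply: openI.
  rewrite (_ : eball r = (@enorm R d) @^-1` [set x | x < r])//.
  by apply: open_comp => [z _|]; [exact: continuous_enorm|exact: open_lt].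
rewrite (_ : ~` _ = (@ynorm R d n) @^-1` [set x | eps < x]).
  by apply: open_comp => [z _|]; [exact: continuous_ynorm|exact: open_gt].
by apply/seteqP; split=> z; rewrite /Sigma /= ltNge => /negP.
Qed.

Lemma shell_measurable : measurable shell.
Proof. by apply: open_measurable_row; exact: shell_open. Qed.

Lemma notSigma_ysq (z : 'rV[R]_d) : ~ Sigma n eps z -> 0 < ysq n z.
Proof.
rewrite /Sigma /= => /negP; rewrite -ltNge => ez.
by rewrite /ysq ynorm_sqr exprn_gt0// (le_lt_trans eps0).
Qed.

Lemma coord_le_enorm (z : 'rV[R]_d) i : `|z ord0 i| <= enorm z.
Proof.
rewrite -sqrtr_sqr ler_wsqrtr// /dotr (bigD1 i)//= -expr2 lerDl.
by apply: sumr_ge0 => j _; rewrite -expr2 sqr_ge0.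
Qed.

Lemma eball_cube (s : R) : (eball s : set 'rV[R]_d) `<=` cube d s.
Proof.
move=> z zr i /=; rewrite in_itv /= -ler_norml; apply: le_trans (coord_le_enorm _ _) _.
exact: ltW.
Qed.

Lemma shell_finite : (mu shell < +oo)%E.
Proof.
apply: le_lt_trans (lebesgue_row_cube d r); apply: le_measure; rewrite ?inE.
- exact: shell_measurable.
- exact: measurable_cube.
- by move=> z [/eball_cube].
Qed.

(** A function of the class off Sigma_eps may blow up near Sigma_eps, but it is
    bounded on the compact set that carries g. *)
Lemma compact_support_integrable (K : set 'rV[R]_d) (g : 'rV[R]_d -> R) :
  compact K -> K `<=` ~` Sigma n eps ->
  smoothly_built (~` Sigma n eps) g -> (forall z, shell z -> ~ K z -> g z = 0) ->
  rintegrable shell g.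
Proof.
move=> cK KS bg g0.
have cg z : ~ Sigma n eps z -> {for z, continuous g}.
  by move=> Sz; exact: smoothly_built_continuous bg _.
apply: measurable_bounded_integrable.
- exact: shell_measurable.
- exact: shell_finite.
- apply: open_continuous_measurable_row; first exact: shell_open.
  by move=> z; rewrite inE => -[_ Sz]; exact: cg.
have cgK : {within K, continuous g}.
  by apply: continuous_in_subspaceT => z; rewrite inE => Kz; apply: cg; exact: KS.
have [N [Nr HN]] := compact_bounded (continuous_compact cgK cK).
exists (`|N|); split; first exact: num_real.
move=> x Nx z Oz /=; have [Kz|Kz] := pselect (K z).
  by apply: (HN x) => /=; [exact: le_lt_trans (ler_norm _) Nx|exists z].
by rewrite g0// normr0; apply: le_trans (ltW Nx).
Qed.

End compact_support.

Section energy_space.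
Context {R : realType} (d n : nat) (a eps r : R).
Hypothesis eps0 : 0 <= eps.
Local Notation mu := (lebesgue_row d).
Local Notation O := (@shell R d n eps r).
Local Notation W := (@weight R d n a).

Lemma measurable_enorm_sqr (D : 'rV[R]_d -> 'rV[R]_d) : measurable_fun O D ->
  measurable_fun O (fun z => enorm (D z) ^+ 2).
Proof.
move=> mD; under eq_fun do rewrite enorm_sqr /dotr.
apply: measurable_sum => i; apply: measurable_funM;
  exact: (measurableT_comp (measurable_row_coord i) mD).
Qed.

Lemma measurable_grad f : smooth f -> measurable_fun setT (grad f : 'rV[R]_d -> 'rV[R]_d).
Proof.
move=> sf; apply/measurable_fun_rowP => i.
rewrite (_ : _ \o _ = pder i f).
  apply: continuous_measurable_row; exact: (smooth_pder i sf [::]).1.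
by apply/funext => z; rewrite /= /row_coord mxE.
Qed.

Lemma enorm_sqr_le (v w : 'rV[R]_d) :
  enorm (v + w) ^+ 2 <= 2 * enorm v ^+ 2 + 2 * enorm w ^+ 2.
Proof.
rewrite !enorm_sqr -subr_ge0.
have := dotr_ge0 (v - w).
by rewrite !(dotrDl, dotrDr, dotrNl, dotrNr) (dotrC w v); lra.
Qed.

(** Off K the function vanishes on an open set. *)
Lemma support_grad f (K : set 'rV[R]_d) : compact K ->
  (forall z, O z -> ~ K z -> f z = 0) -> forall z, O z -> ~ K z -> grad f z = 0.
Proof.
move=> cK f0 z Oz Kz; apply/rowP => i; rewrite !mxE /pder.
have clK : closed K by apply: compact_closed => //; exact: norm_hausdorff.
rewrite (@near_eq_derive _ _ _ f (cst 0)) ?derive_cst//.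
have nO : \forall w \near z, O w.
  by apply: open_nbhs_nbhs; split => //; exact: shell_open.
have nK : \forall w \near z, (~` K) w.
  by apply: open_nbhs_nbhs; split => //; exact: closed_openC.
by near=> w; apply: f0; near: w.
Unshelve. all: by end_near. Qed.

Lemma smooth_cpt_integrable f : smooth_cpt (eclosed_ball r `\` Sigma n eps) f ->
  rintegrable O (fun z => W z * f z ^+ 2) /\
  rintegrable O (fun z => W z * enorm (grad f z) ^+ 2).
Proof.
move=> [sf [K [cK KU f0]]].
have f0' z : O z -> ~ K z -> f z = 0.
  by move=> [zr Sz]; apply: f0; split => //; exact: ltW.
have KS : K `<=` ~` Sigma n eps by move=> z /KU[].
have bW : smoothly_built (~` Sigma n eps) W.
  rewrite (_ : W = (fun z => ysq n z `^ (a / 2))); last first.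
    by apply/funext => z; exact: weight_powR.
  apply: built_powR; first exact: built_quadratic.
  by move=> z; exact: notSigma_ysq.
split; apply: (compact_support_integrable cK KS).
- apply: built_mul => //; apply: built_sqr; exact: built_smooth.
- by move=> z Oz Kz; rewrite f0'// expr0n mulr0.
- apply: built_mul => //.
  rewrite (_ : (fun z => _) = (fun z => \sum_i pder i f z * pder i f z)).
    by apply: built_sum => i; apply: built_mul; apply: built_smooth; exact: smooth_pder.
  by apply/funext => z; rewrite enorm_sqr; apply: eq_bigr => i _; rewrite !mxE.
- move=> z Oz Kz; rewrite (support_grad cK f0')// enorm_sqr dotr0l mulr0//.
Qed.

Definition energy_gap u (Du : 'rV[R]_d -> 'rV[R]_d) (f : 'rV[R]_d -> R) z :=
  W z * ((u z - f z) ^+ 2 + enorm (Du z - grad f z) ^+ 2).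

Lemma tildeH_approx u Du : tildeH_grad n a eps r u Du ->
  forall eta : R, 0 < eta -> exists f,
    [/\ smooth_cpt (eclosed_ball r `\` Sigma n eps) f,
        rintegrable O (energy_gap u Du f) & \int[mu]_(z in O) energy_gap u Du f z <= eta].
Proof.
move=> [mu_ mDu [phi [cphi cv]]] eta eta0.
have e0 : 0 < Num.sqrt eta by rewrite sqrtr_gt0.
(* wnorm is the square root of the integral of energy_gap. *)
pose wk k := wnorm n a eps r (fun z => u z - phi k z) (fun z => Du z - grad (phi k) z).
have [k _ /(_ k (leqnn k)) /= kw] : \forall k \near \oo, (wk k < (Num.sqrt eta)%:E)%E.
  apply: (cv [set x | (x < (Num.sqrt eta)%:E)%E]); apply: open_nbhs_nbhs.
  by split; [exact: open_ereal_lt_ereal|rewrite /= lte_fin].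
pose g1 z := W z * (u z - phi k z) ^+ 2.
pose g2 z := W z * enorm (Du z - grad (phi k) z) ^+ 2.
have g10 z : 0 <= g1 z by rewrite mulr_ge0 ?powR_ge0 ?sqr_ge0.
have g20 z : 0 <= g2 z by rewrite mulr_ge0 ?powR_ge0 ?sqr_ge0.
pose X := (\int[mu]_(z in O) (g1 z)%:E + \int[mu]_(z in O) (g2 z)%:E)%E.
have X0 : (0 <= X)%E.
  by apply: adde_ge0; apply: integral_ge0 => z _; rewrite lee_fin.
have Xle : (X <= eta%:E)%E.
  have h : (X `^ 2^-1 <= (Num.sqrt eta)%:E)%E by exact: ltW kw.
  have hx : (X `^ 2^-1)%E \in `[0%E, +oo%E] by rewrite in_itv /= leey andbT poweR_ge0.
  have hy : (Num.sqrt eta)%:E \in `[0%E, +oo%E].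
    by rewrite in_itv /= leey andbT lee_fin sqrtr_ge0.
  have := @gt0_ler_poweR R 2 (ler0n _ _) _ _ hx hy h.
  rewrite -poweRrM mulVf ?pnatr_eq0// poweRe1//.
  by rewrite poweR_EFin powR_mulrn ?sqrtr_ge0// sqr_sqrtr// ltW.
have mO : measurable O := @shell_measurable R d n eps r.
have [sf _] := cphi k.
have mW : measurable_fun O W by apply: measurable_funTS; exact: measurable_weight.
have mphi : measurable_fun O (phi k).
  by apply: measurable_funTS; apply: continuous_measurable_row; exact: (sf [::]).1.
have mg1 : measurable_fun O g1.
  by apply: measurable_funM => //; apply: measurable_funX; exact: measurable_funB.
have mg2 : measurable_fun O g2.
  have mi i : measurable_fun O (fun z => (Du z - grad (phi k) z) ord0 i).
    rewrite (_ : (fun z => _) = (fun z => row_coord i (Du z) - pder i (phi k) z)).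
      apply: measurable_funB; first exact: (measurableT_comp (measurable_row_coord i) mDu).
      apply: measurable_funTS; apply: continuous_measurable_row.
      exact: (smooth_pder i sf [::]).1.
    by apply/funext => z; rewrite !mxE.
  apply: measurable_funM => //.
  rewrite (_ : (fun z => _) = (fun z => \sum_i (Du z - grad (phi k) z) ord0 i *
      (Du z - grad (phi k) z) ord0 i)); last by apply/funext => z; rewrite enorm_sqr.
  by apply: measurable_sum => i; apply: measurable_funM.
have i0 : (0 <= \int[mu]_(z in O) (g1 z)%:E)%E by apply: integral_ge0 => z _; rewrite lee_fin.
have j0 : (0 <= \int[mu]_(z in O) (g2 z)%:E)%E by apply: integral_ge0 => z _; rewrite lee_fin.
have Xoo := le_lt_trans Xle (ltry eta).
have i1 : rintegrable O g1.
  by apply: ge0_rintegrable => //; apply: le_lt_trans Xoo; rewrite leeDl.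
have i2 : rintegrable O g2.
  by apply: ge0_rintegrable => //; apply: le_lt_trans Xoo; rewrite leeDr.
have gE : energy_gap u Du (phi k) = (fun z => g1 z + g2 z).
  by apply/funext => z; rewrite /energy_gap mulrDr.
exists (phi k); split.
- exact: cphi.
- by rewrite gE; exact: rintegrableD.
- rewrite gE (RintegralD mO i1 i2) -lee_fin EFinD !fineK//.
  + exact: integrable_fin_num i2.
  + exact: integrable_fin_num i1.
Qed.

End energy_space.

(** * The weighted energy inequality for solutions *)

Section absorb.
Context {R : realType}.

(** Passage from an approximation f to u in hardy_pointwise. Products of u or of
    its gradient with a difference are split by Young's inequality, the parameter
    delta weighting the differences by 1/delta and the fixed quantities by delta. *)
Lemma absorb_errors (W u f h B S AD AX Lam X G2 Phi2 D2 delta : R) :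
  0 <= W -> 0 < delta <= 1 -> 0 <= B -> 0 <= Lam -> `|h| <= B ->
  0 <= X -> 0 <= D2 ->
  W * f ^+ 2 * h <= W * (AD + AX) - S ->
  AX <= Lam / 2 * (X / delta + delta * G2) ->
  G2 <= 2 * B * Phi2 + 2 * B * f ^+ 2 -> Phi2 <= 2 * X + 2 * D2 ->
  W * u ^+ 2 * h <= W * AD - S
    + (Lam + 2 * Lam * B + 2 * B) / delta * (W * ((u - f) ^+ 2 + X))
    + (Lam + 2 * Lam * B + 2 * B) * delta * (W * (u ^+ 2 + D2)).
Proof.
move=> W0 /andP[d0 d1] B0 L0 hB X0 D0 H1 H2 H3 H4.
have i1 : 1 <= delta^-1 by rewrite invf_ge1.
have dnz : delta != 0 by rewrite lt0r_neq0.
have f2 : f ^+ 2 <= 2 * (u - f) ^+ 2 + 2 * u ^+ 2.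
  by rewrite -subr_ge0; have := sqr_ge0 (2 * u - f); rewrite !expr2; lra.
have uh : u ^+ 2 * h <= f ^+ 2 * h + B * ((u - f) ^+ 2 / delta + delta * u ^+ 2 + (u - f) ^+ 2).
  rewrite -lerBlDl -mulrBl.
  apply: le_trans (ler_norm _) _; rewrite normrM mulrC.
  apply: ler_pM => //.
  have y1 : 2 * u * (u - f) <= (u - f) ^+ 2 / delta + delta * u ^+ 2.
    have : 0 <= ((u - f) - delta * u) ^+ 2 / delta by rewrite divr_ge0 ?sqr_ge0// ltW.
    have -> : ((u - f) - delta * u) ^+ 2 / delta =
       (u - f) ^+ 2 / delta - 2 * u * (u - f) + delta * u ^+ 2 by field.
    by lra.
  have y2 : - (2 * u * (u - f)) <= (u - f) ^+ 2 / delta + delta * u ^+ 2.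
    have : 0 <= ((u - f) + delta * u) ^+ 2 / delta by rewrite divr_ge0 ?sqr_ge0// ltW.
    have -> : ((u - f) + delta * u) ^+ 2 / delta =
       (u - f) ^+ 2 / delta + 2 * u * (u - f) + delta * u ^+ 2 by field.
    by lra.
  have e : u ^+ 2 - f ^+ 2 = 2 * u * (u - f) - (u - f) ^+ 2 by ring.
  have s0 := sqr_ge0 (u - f).
  by rewrite ler_norml e; apply/andP; split; lra.
set E := (u - f) ^+ 2 in f2 uh *.
have E0 : 0 <= E by exact: sqr_ge0.
have u0 : 0 <= u ^+ 2 by exact: sqr_ge0.
have G2le : G2 <= 4 * B * (X + D2 + E + u ^+ 2).
  apply: le_trans H3 _.
  have := ler_wpM2l (mulr_ge0 (ler0n R 2) B0) (lerD H4 f2).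
  by lra.
have AXle : AX <= Lam / 2 * (X / delta) + 2 * Lam * B * (delta * (X + D2 + E + u ^+ 2)).
  apply: le_trans H2 _.
  have := ler_wpM2l (mulr_ge0 L0 (ltW d0)) G2le.
  by lra.
have main : u ^+ 2 * h - f ^+ 2 * h + AX <=
  (Lam + 2 * Lam * B + 2 * B) / delta * (E + X)
  + (Lam + 2 * Lam * B + 2 * B) * delta * (u ^+ 2 + D2).
  set c := delta^-1 in i1 uh AXle *.
  have LB : 0 <= Lam * B by exact: mulr_ge0.
  have XE : 0 <= X + E by exact: addr_ge0.
  have uD : 0 <= u ^+ 2 + D2 by exact: addr_ge0.
  have dc : delta <= c by lra.
  have c0 : 0 <= c by lra.
  have t1 : Lam * B * (delta * (X + E)) <= Lam * B * (c * (X + E)).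
    by rewrite ler_wpM2l// ler_wpM2r.
  have t2 : B * E <= B * (E * c) by rewrite ler_wpM2l// ler_peMr.
  have t3 : 0 <= Lam * (E * c) by apply: mulr_ge0 => //; apply: mulr_ge0.
  have t4 : 0 <= Lam * (X * c) by apply: mulr_ge0 => //; apply: mulr_ge0.
  have t5 : 0 <= B * (X * c) by apply: mulr_ge0 => //; apply: mulr_ge0.
  have t6 : 0 <= Lam * (delta * (u ^+ 2 + D2)) by apply: mulr_ge0 => //; apply: mulr_ge0 => //; exact: ltW.
  have t7 : 0 <= B * (delta * (u ^+ 2 + D2)) by apply: mulr_ge0 => //; apply: mulr_ge0 => //; exact: ltW.
  have t8 : 0 <= B * (delta * D2) by apply: mulr_ge0 => //; apply: mulr_ge0 => //; exact: ltW.
  have t9 : 0 <= B * (delta * u ^+ 2) by apply: mulr_ge0 => //; apply: mulr_ge0 => //; exact: ltW.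
  by lra.
have := ler_wpM2l W0 main.
by lra.
Qed.

End absorb.

Section core.
Context {R : realType} (d n : nat) (a eps r lam Lam T : R) (A C : 'M[R]_d).
Hypotheses (nd : (n <= d)%N) (eps0 : 0 <= eps)
  (A_sym : A^T = A) (lam0 : 0 < lam) (Lam0 : 0 <= Lam)
  (A_lower : forall xi, lam * enorm xi ^+ 2 <= dotr (mxact A xi) xi)
  (A_upper : forall xi, dotr (mxact A xi) xi <= Lam * enorm xi ^+ 2)
  (C_sym : C^T = C) (YC : @projy R d n *m C = C)
  (YAC : @projy R d n *m A *m C = @projy R d n) (CAC : C *m A *m C = C).
Local Notation mu := (lebesgue_row d).
Local Notation O := (@shell R d n eps r).
Local Notation W := (@weight R d n a).
Local Notation sigma := (2 - a - n%:R).

(** The form of A is nonnegative at xi - delta zeta. *)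
Lemma elliptic_young (xi zeta : 'rV[R]_d) delta : 0 < delta ->
  dotr (mxact A xi) zeta <= Lam / 2 * (enorm xi ^+ 2 / delta + delta * enorm zeta ^+ 2).
Proof.
move=> d0; have := elliptic_ge0 A_sym lam0 A_lower (xi - delta *: zeta).
rewrite mulmxDl mulNmx -scalemxAl !(dotrDl, dotrDr, dotrNl, dotrNr, dotrZl, dotrZr).
rewrite (dotr_mxr zeta xi A) A_sym -!mxactE// (dotrC (mxact A zeta) xi).
rewrite (dotrC xi (mxact A zeta)) {1}[mxact A zeta]mxactE// dotr_mxl A_sym -mxactE//.
rewrite (dotrC zeta (mxact A xi)) (dotrC xi (mxact A xi)) (dotrC zeta (mxact A zeta)).
move=> h; have ux := A_upper xi; have uz := A_upper zeta.
have uz' := ler_wpM2l (sqr_ge0 delta) uz.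
rewrite -(ler_pM2l d0).
have -> : delta * (Lam / 2 * (enorm xi ^+ 2 / delta + delta * enorm zeta ^+ 2)) =
  Lam / 2 * enorm xi ^+ 2 + Lam / 2 * delta ^+ 2 * enorm zeta ^+ 2.
  by field; rewrite lt0r_neq0.
have sy : dotr (mxact A zeta) xi = dotr (mxact A xi) zeta.
  by rewrite !mxactE// dotr_mxl A_sym dotrC.
by rewrite sy in h; lra.
Qed.

Variables (F0 F1 F2 : R -> R).
Hypotheses
  (bF0 : smoothly_built setT (fun z => F0 (qA A z)))
  (bF1 : smoothly_built setT (fun z => F1 (qA A z)))
  (bF2 : smoothly_built setT (fun z => F2 (qA A z)))
  (DF0 : forall t : R, 0 <= t -> is_derive t 1 F0 (F1 t))
  (DF1 : forall t : R, 0 <= t -> is_derive t 1 F1 (F2 t))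
  (F0_ge0 : forall t, 0 <= t -> 0 <= F0 t)
  (F0_out : forall t, T <= t -> F0 t = 0)
  (F1_out : forall t, T <= t -> F1 t = 0)
  (qA_in : forall z, qA A z <= T -> enorm z < r).

Local Notation h := (fun z => - (a + d%:R + 2 * sigma) * F1 (qA A z)
   - 2 * qA A z * F2 (qA A z)).

Lemma qA_ge0 z : 0 <= qA A z.
Proof.
have := elliptic_ge0 A_sym lam0 A_lower (z *m invmx A).
by rewrite mulmxKV ?(elliptic_unit A_sym lam0 A_lower)// dotrC.
Qed.

Lemma built_sub (O1 O2 : set 'rV[R]_d) (f : 'rV[R]_d -> R) : O1 `<=` O2 ->
  smoothly_built O2 f -> smoothly_built O1 f.
Proof.
move=> O12; elim=> {f}.
- by move=> f; exact: built_smooth.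
- exact: built_cst.
- exact: built_coord.
- by move=> f g _ bf _ bg; exact: built_add.
- by move=> f g _ bf _ bg; exact: built_mul.
- by move=> k f _ bf; exact: built_flat.
- by move=> p f _ bf f0; apply: built_powR => // z /O12; exact: f0.
Qed.

Lemma built_bounded (g : 'rV[R]_d -> R) : smoothly_built setT g ->
  exists2 B, 0 <= B & forall z, O z -> `|g z| <= B.
Proof.
move=> bg; have cg : continuous g by move=> z; exact: smoothly_built_continuous bg _.
have [N [Nr HN]] := compact_bounded (continuous_compact (continuous_subspaceT cg) (@compact_cube R d r)).
exists (`|N| + 1); first by rewrite addr_ge0.
move=> z [zr _]; apply: (HN (`|N| + 1)) => /=.
  by rewrite ltr_pwDr// ler_norm.
by exists z => //; exact: eball_cube.
Qed.

(** The continuity of hardy_div comes for free: hardy_field is in the class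
    smoothly_built off Sigma_eps, hence has a partial derivative in that class. *)
Lemma hardy_div_integral (f : 'rV[R]_d -> R) (i : 'I_d) :
  smooth_cpt (eclosed_ball r `\` Sigma n eps) f ->
  rintegrable O (fun z => hardy_div n a A C F0 F1 F2 f (grad f z) i z) /\
  \int[mu]_(z in O) hardy_div n a A C F0 F1 F2 f (grad f z) i z = 0.
Proof.
move=> [sf [K [cK KU f0]]].
pose D z := hardy_div n a A C F0 F1 F2 f (grad f z) i z.
have ys z : O z -> 0 < ysq n z by move=> [_]; exact: notSigma_ysq.
have bH : smoothly_built O (hardy_field n a A C F0 F1 f i).
  apply: built_mul.
    apply: built_mul; last by apply: built_mul; exact: built_smooth.
    by apply: built_powR; [exact: built_quadratic|exact: ys].
  apply: built_add; apply: built_mul.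
  - apply: built_mul; first exact: built_sub bF0.
    apply: built_mul; first exact: built_cst.
    apply: built_powR; first exact: built_quadratic.
    by move=> z /ys; exact: (qC_gt0 A_sym lam0 A_lower C_sym YAC CAC).
  - exact: built_linear.
  - exact: built_sub bF1.
  - exact: built_coord.
have DH z : O z -> is_derive z (delta_mx ord0 i) (hardy_field n a A C F0 F1 f i) (D z).
  move=> Oz; apply: (is_derive_hardy_field a A_sym lam0 A_lower C_sym YAC CAC).
  - exact: ys.
  - by rewrite mxE; have [_ /(_ z i) /derivableP] := sf [::].
  - exact/DF0/qA_ge0.
  - exact/DF1/qA_ge0.
have [g bg Dg] := smoothly_built_is_derive i bH.
have gD z : O z -> g z = D z.
  by move=> Oz; rewrite -(derive_val (is_derive := DH z Oz)); case: (Dg z Oz).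
have cKT : compact (K `&` [set z | qA A z <= T]).
  apply: compact_closedI => //.
  rewrite (_ : [set z | _] = (qA A) @^-1` [set x | x <= T])//.
  apply: closed_comp; last exact: closed_le.
  by move=> z _; exact: continuous_dotr_mx.
have KTO : K `&` [set z | qA A z <= T] `<=` O.
  by move=> z [/KU[_ Sz] /qA_in zr].
have H0 z : O z -> ~ (K `&` [set z | qA A z <= T]) z -> hardy_field n a A C F0 F1 f i z = 0.
  move=> Oz /not_andP; rewrite /hardy_field => -[Kz|/negP].
    by rewrite f0 ?(mulr0, mul0r)//; case: Oz => zr Sz; split => //; exact: ltW.
  by rewrite -ltNge => /ltW Tz; rewrite F0_out// F1_out// !mul0r addr0 mulr0.
have [i1 i2] := integral_derivative_local (@shell_open R d n eps r) cKT KTO Dg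
  (fun z Oz => smoothly_built_continuous bg Oz) H0.
have mO : measurable O := @shell_measurable R d n eps r.
split.
  apply: (eq_integrable mO (EFin \o g)) => //.
  by move=> z; rewrite inE => Oz /=; rewrite gD.
rewrite (@eq_Rintegral _ _ _ mu O g); last by move=> z; rewrite inE => Oz; rewrite gD.
by rewrite /Rintegral i2.
Qed.

Lemma smooth_cpt_profile (f : 'rV[R]_d -> R) :
  smooth_cpt (eclosed_ball r `\` Sigma n eps) f ->
  smooth_cpt (eball r `\` Sigma n eps) (fun z => f z * F0 (qA A z)) /\
  forall z, grad (fun z => f z * F0 (qA A z)) z =
    F0 (qA A z) *: grad f z + (f z * (2 * F1 (qA A z))) *: (z *m invmx A).
Proof.
move=> [sf [K [cK KU f0]]]; split; last first.
  move=> z; apply/rowP => i; rewrite !mxE.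
  have Df : is_derive z (delta_mx ord0 i) f (pder i f z).
    by have [_ /(_ z i) /derivableP] := sf [::].
  have DP := is_derive_quadratic i z (invmx_sym A_sym).
  have D0 := is_derive_lcomp (DF0 (qA_ge0 z)) DP.
  rewrite /pder (derive_val (is_derive := is_deriveM_fun Df D0)) /pder mxE.
  by ring.
split.
  apply: smoothly_built_smooth; apply: built_mul => //; exact: built_smooth.
exists (K `&` [set z | qA A z <= T]); split.
- apply: compact_closedI => //.
  rewrite (_ : [set z | _] = (qA A) @^-1` [set x | x <= T])//.
  apply: closed_comp; last exact: closed_le.
  by move=> z _; exact: continuous_dotr_mx.
- by move=> z [/KU[_ Sz] /qA_in zr].
- move=> z [zr Sz] /not_andP[Kz|/negP].
    by rewrite f0 ?mul0r//; split => //; exact: ltW.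
  by rewrite -ltNge => /ltW Tz; rewrite F0_out// mulr0.
Qed.

Lemma energy_integrable u Du : tildeH_grad n a eps r u Du ->
  rintegrable O (fun z => W z * (u z ^+ 2 + enorm (Du z) ^+ 2)).
Proof.
move=> Hu; have [mu_ mDu _] := Hu.
have mO : measurable O := @shell_measurable R d n eps r.
have mW : measurable_fun O W by apply: measurable_funTS; exact: measurable_weight.
have [f [cf ig _]] := tildeH_approx Hu ltr01.
have [i1 i2] := smooth_cpt_integrable a eps0 cf.
apply: (rintegrable_le mO _ _ (rintegrableZ mO 2 (rintegrableD mO ig (rintegrableD mO i1 i2)))).
  apply: measurable_funM => //; apply: measurable_funD; first exact: measurable_funX.
  exact: measurable_enorm_sqr.
move=> z Oz; have W0 : 0 <= W z by exact: powR_ge0.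
rewrite ger0_norm; last by rewrite mulr_ge0// addr_ge0// sqr_ge0.
rewrite /energy_gap -!mulrDr mulrCA ler_wpM2l//.
have := enorm_sqr_le (Du z - grad f z) (grad f z); rewrite subrK.
have := sqr_ge0 (u z - f z - f z).
by rewrite !expr2; lra.
Qed.

(** Integrate absorb_errors: the divergence integrates to zero, the term with
    A Du . grad (f F0(P)) vanishes by the equation, and the remaining errors are
    O(delta). *)
Lemma weighted_energy_inequality u Du : tildeH_grad n a eps r u Du ->
  (forall phi, smooth_cpt (eball r `\` Sigma n eps) phi ->
     (\int[mu]_(z in eball r `\` Sigma n eps)
       (weight n a z * dotr (mxact A (Du z)) (grad phi z))%:E = 0)%E) ->
  rintegrable O (fun z => W z * u z ^+ 2 * h z) /\
  \int[mu]_(z in O) (W z * u z ^+ 2 * h z) <= 0.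
Proof.
move=> Hu weak; have [mu_ mDu _] := Hu.
have mO : measurable O := @shell_measurable R d n eps r.
have mW : measurable_fun O W by apply: measurable_funTS; exact: measurable_weight.
have ys z : O z -> 0 < ysq n z by move=> [_]; exact: notSigma_ysq.
have W0 z : 0 <= W z by exact: powR_ge0.
have W20 z x : 0 <= W z * x ^+ 2 by exact: mulr_ge0 (W0 z) (sqr_ge0 x).
have bqA : smoothly_built setT (qA A) by exact: built_quadratic.
have bh : smoothly_built setT h.
  apply: built_add; first by apply: built_mul => //; exact: built_cst.
  rewrite (_ : (fun z => _) = (fun z => (-2 * qA A z) * F2 (qA A z))).
    by apply: built_mul => //; apply: built_mul => //; exact: built_cst.
  by apply/funext => z; rewrite !mulNr.
have iM := energy_integrable Hu.
have iWu : rintegrable O (fun z => W z * u z ^+ 2).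
  apply: (rintegrable_le mO _ _ iM); first by apply: measurable_funM => //; exact: measurable_funX.
  move=> z _; rewrite ger0_norm ?W20//.
  by rewrite ler_wpM2l ?W0// lerDl sqr_ge0.
have [B1 B10 hB1] := built_bounded bh.
have iL : rintegrable O (fun z => W z * u z ^+ 2 * h z).
  apply: (rintegrable_le mO _ _ (rintegrableZ mO B1 iWu)).
    apply: measurable_funM; first by apply: measurable_funM => //; exact: measurable_funX.
    apply: measurable_funTS; apply: continuous_measurable_row => z.
    exact: smoothly_built_continuous bh _.
  move=> z Oz; rewrite normrM (ger0_norm (W20 _ _)) mulrC.
  by rewrite ler_wpM2r ?W20// hB1.
split=> //.
have [B2 B20 hB2] := built_bounded (built_sqr bF0).
have bg : smoothly_built setT (fun z => enorm ((2 * F1 (qA A z)) *: (z *m invmx A)) ^+ 2).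
  rewrite (_ : (fun z => _) = (fun z => \sum_i (2 * F1 (qA A z) * (z *m invmx A) ord0 i) *
      (2 * F1 (qA A z) * (z *m invmx A) ord0 i))); last first.
    by apply/funext => z; rewrite enorm_sqr; apply: eq_bigr => i _; rewrite mxE.
  apply: built_sum => i.
  have b1 : smoothly_built setT (fun z => 2 * F1 (qA A z) * (z *m invmx A) ord0 i).
    apply: built_mul; last exact: built_linear.
    by apply: built_mul => //; exact: built_cst.
  exact: built_mul.
have [B3 B30 hB3] := built_bounded bg.
pose B := B1 + B2 + B3.
have B0 : 0 <= B by rewrite !addr_ge0.
pose K := Lam + 2 * Lam * B + 2 * B.
have K0 : 0 <= K by rewrite !addr_ge0 ?mulr_ge0.
pose M := \int[mu]_(z in O) (W z * (u z ^+ 2 + enorm (Du z) ^+ 2)).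
have M0 : 0 <= M by apply: Rintegral_ge0 => z _; rewrite mulr_ge0 ?W0// addr_ge0 ?sqr_ge0.
pose I := \int[mu]_(z in O) (W z * u z ^+ 2 * h z).
suff key delta : 0 < delta <= 1 -> I <= delta * (K * (1 + M)).
  rewrite -/I leNgt; apply/negP => I0.
  have KM0 : 0 <= K * (1 + M) by rewrite mulr_ge0// addr_ge0.
  (* With delta = I / t the bound reads I <= I K (1 + M) / t < I. *)
  pose t := K * (1 + M) + I + 1.
  have t0 : 0 < t by rewrite ltr_pwDr// addr_ge0// ltW.
  have : 0 < I / t <= 1.
    by rewrite divr_gt0//= ler_pdivrMr// mul1r /t -addrA addrCA lerDl addr_ge0.
  move=> /key; rewrite mulrAC ler_pdivlMr// ler_pM2l// /t.
  lra.
move=> /andP[d0 d1].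
have d2 : 0 < delta ^+ 2 by rewrite exprn_gt0.
(* An error delta^2 in the energy survives division by delta as delta. *)
have [f [cf ig gle]] := tildeH_approx Hu d2.
have [sf _] := cf.
have [cpsi Gpsi] := smooth_cpt_profile cf.
pose G z := grad (fun z => f z * F0 (qA A z)) z.
have [j1 j2] := smooth_cpt_integrable a eps0 cf.
pose S z := \sum_i hardy_div n a A C F0 F1 F2 f (grad f z) i z.
have [iS S0] := rintegrable_sum mO (index_enum 'I_d) (fun i => (hardy_div_integral i cf).1).
have {}S0 : \int[mu]_(z in O) S z = 0.
  by rewrite [LHS]S0 big1// => i _; exact: (hardy_div_integral i cf).2.
have G2 z : O z -> enorm (G z) ^+ 2 <= 2 * B * enorm (grad f z) ^+ 2 + 2 * B * f z ^+ 2.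
  move=> Oz; rewrite /G Gpsi.
  apply: le_trans (enorm_sqr_le _ _) _.
  rewrite -scalerA !(enorm_sqr (_ *: _)) !(dotrZl _ (grad f z), dotrZr _ _ (grad f z)).
  rewrite (dotrZl (f z)) (dotrZr (f z)) -!enorm_sqr.
  have h2 := hB2 z Oz; have h3 := hB3 z Oz.
  rewrite ger0_norm ?sqr_ge0// in h2; rewrite ger0_norm ?sqr_ge0// in h3.
  have e1 : F0 (qA A z) ^+ 2 * enorm (grad f z) ^+ 2 <= B * enorm (grad f z) ^+ 2.
    by rewrite ler_wpM2r ?sqr_ge0// /B; lra.
  have e2 : enorm ((2 * F1 (qA A z)) *: (z *m invmx A)) ^+ 2 * f z ^+ 2 <= B * f z ^+ 2.
    by rewrite ler_wpM2r ?sqr_ge0// /B; lra.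
  by lra.
pose AD z := dotr (mxact A (Du z)) (G z).
have mG : measurable_fun O (G : 'rV[R]_d -> 'rV[R]_d).
  by apply: measurable_funTS; exact: measurable_grad cpsi.1.
have iWG : rintegrable O (fun z => W z * enorm (G z) ^+ 2).
  apply: (rintegrable_le mO _ _ (rintegrableD mO (rintegrableZ mO (2 * B) j2)
     (rintegrableZ mO (2 * B) j1))).
    by apply: measurable_funM => //; exact: measurable_enorm_sqr.
  move=> z Oz; rewrite ger0_norm ?W20//.
  by have := ler_wpM2l (W0 z) (G2 z Oz); lra.
have iAD : rintegrable O (fun z => W z * AD z).
  apply: (rintegrable_le mO _ _ (rintegrableZ mO (Lam / 2) (rintegrableD mO iM iWG))).
    apply: measurable_funM => //; rewrite /AD /dotr.
    apply: measurable_sum => i; apply: measurable_funM.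
      rewrite (_ : (fun z => _) = (fun z => \sum_j row_coord j (Du z) * A^T j i)); last first.
        by apply/funext => z; rewrite /mxact mxE.
      apply: measurable_sum => j; apply: measurable_funM => //.
      exact: (measurableT_comp (measurable_row_coord j) mDu).
    exact: (measurableT_comp (measurable_row_coord i) mG).
  move=> z Oz; rewrite normrM (ger0_norm (W0 _)).
  have y1 := elliptic_young (Du z) (G z) ltr01.
  have y2 := elliptic_young (- Du z) (G z) ltr01.
  have En : enorm (- Du z) ^+ 2 = enorm (Du z) ^+ 2.
    by rewrite !enorm_sqr dotrNl dotrNr opprK.
  have Mn : dotr (mxact A (- Du z)) (G z) = - AD z by rewrite /mxact mulNmx dotrNl.
  have ADle : `|AD z| <= Lam / 2 * (enorm (Du z) ^+ 2 + enorm (G z) ^+ 2).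
    rewrite En Mn in y2; rewrite ler_norml; apply/andP; split; rewrite /AD in y2 *; lra.
  have u0 : 0 <= Lam / 2 * (W z * u z ^+ 2) by rewrite mulr_ge0 ?W20// divr_ge0.
  by have := ler_wpM2l (W0 z) ADle; lra.
have AD0 : \int[mu]_(z in O) (W z * AD z) = 0 by rewrite /Rintegral (weak _ cpsi).
have bnd z : O z -> W z * u z ^+ 2 * h z <= W z * AD z - S z
    + K / delta * energy_gap n a u Du f z + K * delta * (W z * (u z ^+ 2 + enorm (Du z) ^+ 2)).
  move=> Oz; apply: (@absorb_errors R (W z) (u z) (f z) (h z) B (S z) (AD z)
    (dotr (mxact A (grad f z - Du z)) (G z)) Lam (enorm (Du z - grad f z) ^+ 2)
    (enorm (G z) ^+ 2) (enorm (grad f z) ^+ 2)) => //; rewrite ?sqr_ge0//.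
  - by rewrite d0 d1.
  - by apply: le_trans (hB1 z Oz) _; rewrite /B; lra.
  - rewrite /AD -dotrDl.
    have -> : mxact A (Du z) + mxact A (grad f z - Du z) = mxact A (grad f z).
      by rewrite /mxact -mulmxDl addrC subrK.
    rewrite weight_powR /G Gpsi.
    apply: (hardy_pointwise a nd A_sym lam0 A_lower C_sym YC YAC CAC) => //.
      exact: ys.
    exact/F0_ge0/qA_ge0.
  - have := elliptic_young (grad f z - Du z) (G z) d0.
    by rewrite -[grad f z - Du z]opprB !enorm_sqr dotrNl dotrNr opprK.
  - exact: G2.
  - have := enorm_sqr_le (grad f z - Du z) (Du z); rewrite subrK.
    by rewrite -[grad f z - Du z]opprB !enorm_sqr dotrNl dotrNr opprK.
have iA1 := rintegrableB mO iAD iS.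
have iA2 := rintegrableZ mO (K / delta) ig.
have iA3 := rintegrableZ mO (K * delta) iM.
have iA12 := rintegrableD mO iA1 iA2.
apply: le_trans (le_Rintegral mO iL (rintegrableD mO iA12 iA3) bnd) _.
rewrite (RintegralD mO iA12 iA3) (RintegralD mO iA1 iA2) (RintegralB mO iAD iS).
rewrite (RintegralZl _ mO ig) (RintegralZl _ mO iM) AD0 S0 subrr add0r -/M.
have : K / delta * \int[mu]_(z in O) energy_gap n a u Du f z <= K / delta * delta ^+ 2.
  by rewrite ler_wpM2l// divr_ge0// ltW.
have -> : K / delta * delta ^+ 2 = K * delta by field; rewrite lt0r_neq0.
by lra.
Qed.

End core.

(** * Radial profiles *)

Section cutoff.
Context {R : realType}.
Local Notation fl := (@flat R).

Definition step_arg (x : R) : R := fl 0 1 - fl 0 x.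
(** step0 is a smooth function equal to a positive constant on x <= 0 and to 0 on
    x >= 1; nesting flat 0 in itself gives such a plateau without any quotient.
    step1 and step2 are its first two derivatives. *)
Definition step0 (x : R) : R := fl 0 (step_arg x).
Definition step1 (x : R) : R := fl 2 (step_arg x) * (- fl 2 x).
Definition step2 (x : R) : R :=
  (fl 4 (step_arg x) - 2 * fl 3 (step_arg x)) * (fl 2 x * fl 2 x)
  - fl 2 (step_arg x) * (fl 4 x - 2 * fl 3 x).

Lemma is_derive_step_arg (x : R) : is_derive x 1 step_arg (- fl 2 x).
Proof.
have D := flat_derive 0 x; rewrite mul0r subr0 in D.
apply: (is_derive_eq (is_deriveB (is_derive_cst (fl 0 1) x 1) D)).
by rewrite sub0r.
Qed.

Lemma is_derive_step0 (x : R) : is_derive x 1 step0 (step1 x).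
Proof.
have D := flat_derive 0 (step_arg x); rewrite mul0r subr0 in D.
exact: (is_derive_lcomp D (is_derive_step_arg x)).
Qed.

Lemma is_derive_step1 (x : R) : is_derive x 1 step1 (step2 x).
Proof.
have D1 := is_derive_lcomp (flat_derive 2 (step_arg x)) (is_derive_step_arg x).
have D2 := is_deriveN (flat_derive 2 x).
apply: (is_derive_eq (is_deriveM_fun (g := fun x => - fl 2 x) D1 D2)).
by rewrite /step2 /=; ring.
Qed.

Lemma step_le0 (x : R) : x <= 0 ->
  [/\ step0 x = fl 0 (fl 0 1), step1 x = 0 & step2 x = 0].
Proof.
move=> x0; rewrite /step0 /step1 /step2 /step_arg !(flat_le0 _ x0).
by split; rewrite !(oppr0, mulr0, subr0).
Qed.

Lemma step_ge1 (x : R) : 1 <= x -> [/\ step0 x = 0, step1 x = 0 & step2 x = 0].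
Proof.
move=> x1; have s0 : step_arg x <= 0 by rewrite subr_le0; exact: flat0_le.
rewrite /step0 /step1 /step2 !(flat_le0 _ s0).
by split=> //; rewrite !(mulr0, subr0, mul0r).
Qed.

Lemma step0_ge0 (x : R) : 0 <= step0 x.
Proof. exact: flat_ge0. Qed.

Lemma step_bounded : exists2 E : R, 0 <= E & forall x, 0 <= x <= 1 ->
  [/\ `|step0 x| <= E, `|step1 x| <= E & `|step2 x| <= E].
Proof.
have bd (f : R -> R) : continuous f ->
    exists2 E : R, 0 <= E & forall x, 0 <= x <= 1 -> `|f x| <= E.
  move=> cf.
  have [N [Nr HN]] := compact_bounded (continuous_compact (continuous_subspaceT cf)
    (@segment_compact R 0 1)).
  exists (`|N| + 1); first by rewrite addr_ge0.
  move=> x x01; apply: (HN (`|N| + 1)) => /=.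
    by rewrite ltr_pwDr// ler_norm.
  by exists x => //; rewrite /= in_itv.
have dc (f : R -> R) : (forall x : R, derivable f x 1) -> continuous f.
  by move=> df x; apply: differentiable_continuous; exact/derivable1_diffP.
have c0 : continuous step0 by apply: dc => x; case: (is_derive_step0 x).
have c1 : continuous step1 by apply: dc => x; case: (is_derive_step1 x).
have c2 : continuous step2.
  apply: dc => x; have Ds := is_derive_step_arg x.
  have a j := is_derive_lcomp (flat_derive j (step_arg x)) Ds.
  have b j := flat_derive j x.
  have D2 := is_derive_cst (2 : R) x 1.
  have D := is_deriveB (is_deriveM_fun (is_deriveB (a 4%N) (is_deriveM_fun D2 (a 3%N)))
    (is_deriveM_fun (b 2%N) (b 2%N)))
    (is_deriveM_fun (a 2%N) (is_deriveB (b 4%N) (is_deriveM_fun D2 (b 3%N)))).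
  exact: (ex_derive (is_derive := D)).
have [E0 E00 h0] := bd _ c0; have [E1 E10 h1] := bd _ c1; have [E2 E20 h2] := bd _ c2.
exists (E0 + E1 + E2) => [|x x01]; first by rewrite !addr_ge0.
have := h0 x x01; have := h1 x x01; have := h2 x x01.
by split; lra.
Qed.

Variables (m k : R).
Hypotheses (m0 : 0 < m) (k0 : 0 < k).

Definition decay (t : R) : R := (1 + t) `^ (- (m / 2)).
Definition inv1p (t : R) : R := (1 + t) `^ (- 1).

(** With k = 2/T, this is (1 + t)^(-m/2) times a plateau function that is constant
    for t <= T/2 and zero for t >= T; profile1 and profile2 are its first two
    derivatives. *)
Definition profile0 (t : R) : R := decay t * step0 (k * t - 1).
Definition profile1 (t : R) : R :=
  decay t * (- (m / 2) * inv1p t * step0 (k * t - 1) + k * step1 (k * t - 1)).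
Definition profile2 (t : R) : R :=
  decay t * ((m / 2) * (m / 2 + 1) * inv1p t ^+ 2 * step0 (k * t - 1)
   - m * inv1p t * k * step1 (k * t - 1) + k ^+ 2 * step2 (k * t - 1)).

Lemma is_derive_decay (t : R) : 0 <= t -> is_derive t 1 decay (- (m / 2) * inv1p t * decay t).
Proof.
move=> t0; have t1 : 0 < 1 + t by rewrite ltr_pwDl.
have Dt : is_derive t 1 (fun t : R => 1 + t) 1.
  apply: (is_derive_eq (is_deriveD_fun (is_derive_cst (1 : R) t 1) (is_derive_id t (1 : R)))).
  by rewrite add0r.
apply: (is_derive_eq (is_derive_lcomp (is_derive1_powR (- (m / 2)) t1) Dt)).
rewrite mulr1 powRD; last by rewrite lt0r_neq0// implybT.
by rewrite /inv1p /decay; ring.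
Qed.

Lemma is_derive_inv1p (t : R) : 0 <= t -> is_derive t 1 inv1p (- inv1p t ^+ 2).
Proof.
move=> t0; have t1 : 0 < 1 + t by rewrite ltr_pwDl.
have Dt : is_derive t 1 (fun t : R => 1 + t) 1.
  apply: (is_derive_eq (is_deriveD_fun (is_derive_cst (1 : R) t 1) (is_derive_id t (1 : R)))).
  by rewrite add0r.
apply: (is_derive_eq (is_derive_lcomp (is_derive_powRN1 t1) Dt)).
by rewrite mulr1 /inv1p powR_inv1// ltW.
Qed.

Lemma is_derive_affine (t : R) : is_derive t 1 (fun t : R => k * t - 1) k.
Proof.
apply: (is_derive_eq (is_deriveB (is_deriveM_fun (is_derive_cst k t 1) (is_derive_id t (1 : R)))
  (is_derive_cst (1 : R) t 1))).
by rewrite /=; ring.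
Qed.

Lemma is_derive_profile0 (t : R) : 0 <= t -> is_derive t 1 profile0 (profile1 t).
Proof.
move=> t0; have Ds := is_derive_lcomp (f := fun t : R => k * t - 1) (is_derive_step0 _)
  (is_derive_affine t).
apply: (is_derive_eq (is_deriveM_fun (is_derive_decay t0) Ds)).
by rewrite /profile1; ring.
Qed.

Lemma is_derive_profile1 (t : R) : 0 <= t -> is_derive t 1 profile1 (profile2 t).
Proof.
move=> t0; have Ds := is_derive_lcomp (f := fun t : R => k * t - 1) (is_derive_step0 _)
  (is_derive_affine t).
have Ds1 := is_derive_lcomp (f := fun t : R => k * t - 1) (is_derive_step1 _)
  (is_derive_affine t).
have D1 := is_deriveM_fun (is_deriveM_fun (is_derive_cst (- (m / 2)) t 1) (is_derive_inv1p t0)) Ds.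
have D2 := is_deriveM_fun (is_derive_cst k t 1) Ds1.
apply: (is_derive_eq (is_deriveM_fun (is_derive_decay t0) (is_deriveD_fun D1 D2))).
by rewrite /profile2 /=; field.
Qed.

Lemma built_profile d (q : 'rV[R]_d -> R) : smoothly_built setT q -> (forall z, 0 <= q z) ->
  [/\ smoothly_built setT (fun z => profile0 (q z)),
      smoothly_built setT (fun z => profile1 (q z)) &
      smoothly_built setT (fun z => profile2 (q z))].
Proof.
move=> bq q0.
have cst x : smoothly_built setT (fun _ : 'rV[R]_d => x) by exact: built_cst.
have bneg (f : 'rV[R]_d -> R) : smoothly_built setT f -> smoothly_built setT (fun z => - f z).
  move=> bf; rewrite (_ : (fun z => _) = (fun z => - 1 * f z)); first exact: built_mul.
  by apply/funext => z; rewrite mulN1r.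
have bp p : smoothly_built setT (fun z => (1 + q z) `^ p).
  by apply: built_powR; [exact: built_add|move=> z _; rewrite ltr_pwDl].
have bx : smoothly_built setT (fun z => k * q z - 1) by apply: built_add => //; exact: built_mul.
have bs : smoothly_built setT (fun z => step_arg (k * q z - 1)).
  by apply: built_add => //; apply: bneg; exact: built_flat.
have b0 : smoothly_built setT (fun z => step0 (k * q z - 1)) by exact: built_flat.
have b1 : smoothly_built setT (fun z => step1 (k * q z - 1)).
  by apply: built_mul; [exact: built_flat|apply: bneg; exact: built_flat].
have b43 (f : 'rV[R]_d -> R) : smoothly_built setT f ->
    smoothly_built setT (fun z => fl 4 (f z) - 2 * fl 3 (f z)).
  move=> bf; apply: built_add; first exact: built_flat.
  by apply: bneg; apply: built_mul => //; exact: built_flat.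
have b2 : smoothly_built setT (fun z => step2 (k * q z - 1)).
  apply: built_add; first by apply: built_mul; [exact: b43|apply: built_mul; exact: built_flat].
  by apply: bneg; apply: built_mul; [exact: built_flat|exact: b43].
split.
- by apply: built_mul => //; exact: bp.
- apply: built_mul; first exact: bp.
  apply: built_add; last exact: built_mul.
  by apply: built_mul => //; apply: built_mul => //; exact: bp.
- apply: built_mul; first exact: bp.
  apply: built_add; last exact: built_mul.
  apply: built_add.
    apply: built_mul => //; apply: built_mul => //; apply: built_sqr; exact: bp.
  apply: bneg; apply: built_mul => //; apply: built_mul => //; apply: built_mul => //; exact: bp.
Qed.

Lemma profile_out (t : R) : 2 <= k * t -> profile0 t = 0 /\ profile1 t = 0 /\ profile2 t = 0.
Proof.
move=> kt; have x1 : 1 <= k * t - 1 by lra.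
have [s0 s1 s2] := step_ge1 x1.
by rewrite /profile0 /profile1 /profile2 s0 s1 s2 !mulr0 subr0 !addr0 mulr0.
Qed.

Lemma profile0_ge0 (t : R) : 0 <= profile0 t.
Proof. by rewrite mulr_ge0 ?powR_ge0 ?step0_ge0. Qed.

(** The density h of the Hardy-type inequality for the profile F = profile0, as
    m + 2 = d + a + 2 sigma. *)
Definition profile_h (t : R) : R := - (m + 2) * profile1 t - 2 * t * profile2 t.

Lemma profile_h_inner (t : R) : 0 <= t -> k * t <= 1 ->
  profile_h t = fl 0 (fl 0 1) * (m / 2 * (m + 2)) * (decay t * inv1p t ^+ 2).
Proof.
move=> t0 kt; have x0 : k * t - 1 <= 0 by lra.
have [s0 s1 s2] := step_le0 x0.
have rE : inv1p t = (1 + t)^-1 by rewrite /inv1p powR_inv1// addr_ge0.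
rewrite /profile_h /profile1 /profile2 s0 s1 s2 rE.
by field; rewrite lt0r_neq0// ltr_pwDl.
Qed.

Lemma profile_h_out (t : R) : 2 <= k * t -> profile_h t = 0.
Proof. by move=> /profile_out[_ [p1 p2]]; rewrite /profile_h p1 p2 !mulr0 subr0. Qed.

(** Every derivative falling on the profile costs a factor k = 2/T, while
    2 t k <= 4 absorbs the factor t. *)
Lemma profile_h_annulus (E t : R) :
  (forall x, 0 <= x <= 1 -> [/\ `|step0 x| <= E, `|step1 x| <= E & `|step2 x| <= E]) ->
  0 <= t -> 1 <= k * t <= 2 ->
  `|profile_h t| <= E * ((m + 2) * (m / 2 + 1) + 4 * (m / 2 * (m / 2 + 1) + m + 1))
     * k `^ (m / 2 + 1).
Proof.
move=> hE t0 /andP[kt1 kt2].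
have x01 : 0 <= k * t - 1 <= 1 by apply/andP; split; lra.
have [] := hE _ x01.
set s0 := step0 _; set s1 := step1 _; set s2 := step2 _ => e0 e1 e2.
have E0 : 0 <= E by apply: le_trans e0.
have r0 : 0 <= inv1p t by exact: powR_ge0.
have o0 : 0 <= decay t by exact: powR_ge0.
have t1 : 0 < 1 + t by rewrite ltr_pwDl.
have kit : k^-1 <= 1 + t.
  by rewrite -(ler_pM2l k0) mulfV ?lt0r_neq0// mulrDr mulr1 ler_wpDl// ltW.
have rk : inv1p t <= k.
  have := kit; rewrite -lef_pV2 ?posrE ?invr_gt0// invrK.
  by rewrite /inv1p powR_inv1 ?(ltW t1).
have ok : decay t <= k `^ (m / 2).
  have -> : k `^ (m / 2) = (k^-1 `^ (m / 2))^-1.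
    by rewrite -(powR_inv1 (ltW k0)) -powRrM mulN1r powRN invrK.
  rewrite /decay powRN lef_pV2 ?posrE ?powR_gt0 ?invr_gt0//.
  by apply: ge0_ler_powR; rewrite ?nnegrE ?invr_ge0 ?divr_ge0// ltW.
have k0' := ltW k0; have m0' := ltW m0.
pose Q := (m + 2) * (m / 2) * inv1p t * s0 - (m + 2) * k * s1
  - (2 * t * (m / 2 * (m / 2 + 1) * inv1p t ^+ 2) * s0 - 2 * t * m * inv1p t * k * s1
     + 2 * t * k ^+ 2 * s2).
have -> : profile_h t = decay t * Q by rewrite /profile_h /profile1 /profile2 -/s0 -/s1 -/s2 /Q; ring.
have term c x y : 0 <= c -> c <= y -> `|x| <= E -> `|c * x| <= y * E.
  move=> c0 cy xE; rewrite normrM ger0_norm//; apply: ler_pM => //.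
have tk : t * k <= 2 by rewrite mulrC.
have tkk : 2 * t * k * k <= 4 * k by rewrite ler_wpM2r//; lra.
have tr : 2 * t * k * inv1p t <= 4 * k.
  apply: le_trans tkk; apply: ler_wpM2l => //.
  by apply: mulr_ge0 => //; exact: mulr_ge0.
have trr : 2 * t * (inv1p t * inv1p t) <= 4 * k.
  apply: le_trans tr; rewrite -[2 * t * k * _]mulrA.
  apply: ler_wpM2l; first exact: mulr_ge0.
  exact: ler_wpM2r.
have q1 : `|(m + 2) * (m / 2) * inv1p t * s0| <= (m + 2) * (m / 2) * k * E.
  apply: term => //; first by rewrite !mulr_ge0 ?addr_ge0 ?divr_ge0.
  by rewrite ler_wpM2l ?mulr_ge0 ?addr_ge0 ?divr_ge0.
have q2 : `|(m + 2) * k * s1| <= (m + 2) * k * E.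
  by apply: term => //; rewrite mulr_ge0 ?addr_ge0.
have q3 : `|2 * t * (m / 2 * (m / 2 + 1) * inv1p t ^+ 2) * s0| <= 4 * k * (m / 2 * (m / 2 + 1)) * E.
  apply: term => //; first by rewrite !mulr_ge0 ?addr_ge0 ?divr_ge0 ?sqr_ge0.
  rewrite [X in X <= _](_ : _ = 2 * t * (inv1p t * inv1p t) * (m / 2 * (m / 2 + 1))); last by ring.
  by rewrite ler_wpM2r// !mulr_ge0 ?addr_ge0 ?divr_ge0.
have q4 : `|2 * t * m * inv1p t * k * s1| <= 4 * k * m * E.
  apply: term => //; first by rewrite !mulr_ge0.
  rewrite [X in X <= _](_ : _ = 2 * t * k * inv1p t * m); last by ring.
  by rewrite ler_wpM2r.
have q5 : `|2 * t * k ^+ 2 * s2| <= 4 * k * E.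
  apply: term => //; first by rewrite !mulr_ge0 ?sqr_ge0.
  by rewrite expr2 mulrA.
have QE : `|Q| <= E * ((m + 2) * (m / 2 + 1) + 4 * (m / 2 * (m / 2 + 1) + m + 1)) * k.
  move: q1 q2 q3 q4 q5; rewrite /Q !ler_norml => /andP[? ?] /andP[? ?] /andP[? ?]
    /andP[? ?] /andP[? ?].
  by apply/andP; split; lra.
rewrite normrM ger0_norm//.
have -> : k `^ (m / 2 + 1) = k `^ (m / 2) * k.
  by rewrite powRD ?powRr1// lt0r_neq0// implybT.
by rewrite mulrCA ler_pM// mulrC.
Qed.

End cutoff.

(** * The Liouville theorem *)

Section liouville.
Context {R : realType} (d n : nat) (a eps : R) (A : 'M[R]_d) (lam Lam : R)
  (u : 'rV[R]_d -> R) (c gamma : R).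
Hypotheses (n_ge2 : (2 <= n)%N) (n_le_d : (n <= d)%N)
  (an_gt0 : 0 < a + n%:R) (an_lt2 : a + n%:R < 2)
  (eps_ge0 : 0 <= eps) (A_sym : A^T = A) (lam_gt0 : 0 < lam) (lam_le_Lam : lam <= Lam)
  (A_lower : forall xi : 'rV[R]_d, lam * enorm xi ^+ 2 <= dotr (mxact A xi) xi)
  (A_upper : forall xi : 'rV[R]_d, dotr (mxact A xi) xi <= Lam * enorm xi ^+ 2)
  (u_sol : entire_solution n a eps A u)
  (c_gt0 : 0 < c) (gamma_gt0 : 0 < gamma) (gamma_lt : gamma < 2 - a - n%:R)
  (u_growth : {ae lebesgue_row d, forall z, ~ Sigma n eps z ->
       `|u z| <= c * (1 + enorm z `^ gamma)}).
Local Notation mu := (lebesgue_row d).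
Local Notation W := (@weight R d n a).
Local Notation sigma := (2 - a - n%:R).
Let Lam_gt0 : 0 < Lam := lt_le_trans lam_gt0 lam_le_Lam.

(** The form of A is nonnegative at z/Lam - A^-1 z. *)
Lemma enorm_le_qA z : enorm z ^+ 2 <= Lam * qA A z.
Proof.
have Au := elliptic_unit A_sym lam_gt0 A_lower.
have := elliptic_ge0 A_sym lam_gt0 A_lower (Lam^-1 *: z - z *m invmx A).
rewrite mulmxDl mulNmx -scalemxAl mulmxKV//.
rewrite !(dotrDl, dotrDr, dotrNl, dotrNr, dotrZl, dotrZr).
rewrite (dotr_mxr (z *m invmx A) z A) A_sym mulmxKV// -/(qA A z).
rewrite (dotrC (z *m invmx A) z) -/(qA A z).
have := A_upper z; rewrite mxactE// dotrC enorm_sqr => h1 h2.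
have L0 : Lam != 0 by rewrite lt0r_neq0.
have := mulr_ge0 (ltW Lam_gt0) h2.
have h3 : Lam * (Lam^-1 * (Lam^-1 * dotr z (z *m A))) <= dotr z z.
  have -> : Lam * (Lam^-1 * (Lam^-1 * dotr z (z *m A))) = dotr z (z *m A) / Lam by field.
  by rewrite ler_pdivrMr// mulrC.
rewrite [X in 0 <= X -> _](_ : _ = Lam * (Lam^-1 * (Lam^-1 * dotr z (z *m A)))
   - 2 * dotr z z + Lam * qA A z); last by field.
by lra.
Qed.

Definition level T : set 'rV[R]_d := ~` Sigma n eps `&` [set z | qA A z <= T].

Lemma enorm_le_sqrt T z : 0 <= T -> qA A z <= T -> enorm z <= Num.sqrt (Lam * T).
Proof.
move=> T0 zT; rewrite -ler_sqr ?nnegrE ?enorm_ge0 ?sqrtr_ge0//.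
have LT : 0 <= Lam * T by rewrite mulr_ge0// ltW.
rewrite [leRHS]sqr_sqrtr//; apply: le_trans (enorm_le_qA z) _.
by rewrite ler_pM2l.
Qed.

Lemma measurable_level T : measurable (level T).
Proof.
apply: measurableI.
  apply: measurableC; rewrite -[X in measurable X]setTI.
  rewrite (_ : Sigma n eps = (@ynorm R d n) @^-1` `]-oo, eps]%classic).
    by apply: (continuous_measurable_row (@continuous_ynorm R d n)).
  by apply/seteqP; split=> z; rewrite /Sigma /= in_itv.
rewrite -[X in measurable X]setTI (_ : [set z | _] = (qA A) @^-1` `]-oo, T]%classic).
  have cq : continuous (qA A : 'rV[R]_d -> R) by exact: continuous_dotr_mx.
  exact: (continuous_measurable_row cq measurableT (measurable_itv _)).
by apply/seteqP; split=> z; rewrite /= in_itv.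
Qed.

Lemma level_shell T r : 0 <= T -> Num.sqrt (Lam * T) < r -> level T `<=` shell n eps r.
Proof.
by move=> T0 Tr z [Sz zT]; split => //; exact: le_lt_trans (enorm_le_sqrt T0 zT) Tr.
Qed.

(** Each level is contained in some ball, on which u is known to be Borel. *)
Lemma sol_measurable T : 0 <= T -> measurable_fun (level T) u.
Proof.
move=> T0; have r0 : 0 < Num.sqrt (Lam * T) + 1 by rewrite ltr_wpDl ?sqrtr_ge0.
have [Du [mu_ _ _] _] := u_sol r0.
apply: measurable_funS mu_; first exact: (@shell_measurable R d n eps).
by apply: level_shell => //; rewrite ltrDl.
Qed.

(** On the level T the growth bound reads u^2 = O(T^gamma), and the level lies in
    the cube of half-side sqrt (Lam T), where the weight has mass
    O(T^((d + a)/2)). *)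
Lemma level_mass : exists2 K : R, 0 <= K & forall T, 1 <= T ->
  (\int[mu]_(z in level T) (W z * u z ^+ 2)%:E <= (K * T `^ (gamma + (d%:R + a) / 2))%:E)%E.
Proof.
have n0d : (0 < n <= d)%N by rewrite n_le_d andbT (leq_trans _ n_ge2).
have n2 : 2 <= n%:R :> R by rewrite ler_nat.
have a0 : a <= 0 by move: an_lt2; lra.
have [K K0 hK] := integral_weight_cube n0d a0 an_gt0.
pose c1 := 2 * c ^+ 2 * (1 + Lam `^ gamma).
have c10 : 0 <= c1.
  by apply: mulr_ge0; [exact: mulr_ge0 (ler0n _ 2) (sqr_ge0 c)|exact: addr_ge0 ler01 (powR_ge0 _ _)].
exists (c1 * (K * Lam `^ ((d%:R + a) / 2))).
  by apply: mulr_ge0 => //; apply: mulr_ge0 => //; exact: powR_ge0.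
move=> T T1; have T0 : 0 < T by lra.
have LT0 : 0 < Lam * T by rewrite mulr_gt0.
have W0 z : 0 <= W z by exact: powR_ge0.
have mW D : measurable_fun D W by apply: measurable_funTS; exact: measurable_weight.
have cT0 : 0 <= c1 * T `^ gamma by apply: mulr_ge0 => //; exact: powR_ge0.
pose rho := Num.sqrt (Lam * T).
have rho0 : 0 < rho by rewrite sqrtr_gt0.
apply: (@le_trans _ _ (\int[mu]_(z in level T) ((c1 * T `^ gamma) * W z)%:E)%E).
  apply: ae_ge0_le_integral => //.
  - exact: measurable_level.
  - by move=> z _; rewrite lee_fin; exact: mulr_ge0 (W0 z) (sqr_ge0 _).
  - apply/measurable_EFinP/measurable_funM => //; apply: measurable_funX.
    by apply: sol_measurable; lra.
  - by move=> z _; rewrite lee_fin; exact: mulr_ge0 cT0 (W0 z).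
  - by apply/measurable_EFinP/measurable_funM.
  apply: filterS u_growth => z gz [Sz zT]; rewrite lee_fin mulrC ler_wpM2r//.
  have := gz Sz; set x := enorm z `^ gamma => ux.
  have x0 : 0 <= x by exact: powR_ge0.
  have xT : x ^+ 2 <= Lam `^ gamma * T `^ gamma.
    have -> : x ^+ 2 = (enorm z ^+ 2) `^ gamma.
      by rewrite -(powR_mulrn 2 (enorm_ge0 z)) -(powR_mulrn 2 x0) /x -!powRrM mulrC.
    rewrite -(powRM _ (ltW Lam_gt0) (ltW T0)).
    apply: (ge0_ler_powR (ltW gamma_gt0)); rewrite ?nnegrE ?sqr_ge0//; first exact: ltW.
    by apply: le_trans (enorm_le_qA z) _; rewrite ler_pM2l.
  have Tg : 1 <= T `^ gamma by rewrite -(powRr0 T) ler_powR// ltW.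
  have u2 : u z ^+ 2 <= (c * (1 + x)) ^+ 2.
    by rewrite -[u z ^+ 2]real_normK ?num_real// lerXn2r ?nnegrE// mulr_ge0 ?addr_ge0// ltW.
  apply: le_trans u2 _; rewrite exprMn.
  have : (1 + x) ^+ 2 <= 2 * (1 + Lam `^ gamma) * T `^ gamma.
    have : 0 <= (1 - x) ^+ 2 by exact: sqr_ge0.
    by lra.
  by move=> /(ler_wpM2l (sqr_ge0 c)); rewrite /c1; lra.
apply: (@le_trans _ _ (\int[mu]_(z in cube d rho) ((c1 * T `^ gamma) * W z)%:E)%E).
  apply: ge0_subset_integral.
  - exact: measurable_level.
  - exact: measurable_cube.
  - by apply/measurable_EFinP/measurable_funM.
  - by move=> z _; rewrite lee_fin; exact: mulr_ge0 cT0 (W0 z).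
  - move=> z [_ zT] i; rewrite /= in_itv /= -ler_norml.
    by apply: le_trans (coord_le_enorm _ _) (enorm_le_sqrt (ltW T0) zT).
under eq_integral do rewrite EFinM.
have mWE : measurable_fun (cube d rho) (EFin \o W) by apply/measurable_EFinP.
rewrite (ge0_integralZl mu (@measurable_cube R d rho) mWE) ?lee_fin//; last first.
  by move=> z _; rewrite lee_fin.
apply: le_trans (lee_wpmul2l _ (hK rho rho0)) _; first by rewrite lee_fin.
have -> : rho `^ (d%:R + a) = Lam `^ ((d%:R + a) / 2) * T `^ ((d%:R + a) / 2).
  rewrite -(powRM _ (ltW Lam_gt0) (ltW T0)) /rho -(powR12_sqrt (ltW LT0)) -powRrM.
  by rewrite [2^-1 * _]mulrC.
rewrite -EFinM lee_fin powRD; last by rewrite (lt0r_neq0 T0) implybT.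
by rewrite le_eqVlt; apply/orP; left; apply/eqP; ring.
Qed.

Lemma Rintegral_indic (O D : set 'rV[R]_d) (f : 'rV[R]_d -> R) : D `<=` O ->
  measurable O -> measurable D -> rintegrable D f ->
  rintegrable O (fun z => f z * \1_D z) /\
  \int[mu]_(z in O) (f z * \1_D z) = \int[mu]_(z in D) f z.
Proof.
move=> DO mO mD fi.
have E : (EFin \o (fun z => f z * \1_D z)) \_ O = (EFin \o f) \_ D.
  apply/funext => z; rewrite !patchE /= indicE.
  have [/set_mem Dz|_] := boolP (z \in D); first by rewrite mem_set ?mulr1//; exact: DO.
  by rewrite /= mulr0; case: ifP.
split; first by apply/(integrable_mkcond _ mO); rewrite E; apply/(integrable_mkcond _ mD).
by rewrite /Rintegral integral_mkcond [in RHS]integral_mkcond E.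
Qed.

Lemma level_integrable T : 1 <= T -> rintegrable (level T) (fun z => W z * u z ^+ 2).
Proof.
move=> T1; have [K _ hK] := level_mass; apply: ge0_rintegrable.
- apply: measurable_funM; first by apply: measurable_funTS; exact: measurable_weight.
  by apply: measurable_funX; apply: sol_measurable; lra.
- by move=> z _; exact: mulr_ge0 (powR_ge0 _ _) (sqr_ge0 _).
- exact: le_lt_trans (hK T T1) (ltry _).
Qed.

(** The inequality of weighted_energy_inequality with the profile cut off at T
    bounds a fixed multiple of the integral over level T0 by
    O(T^(-m/2 - 1)) times the mass of level T, that is O(T^(gamma - sigma)). *)
Lemma level_vanish T0 : 1 <= T0 -> \int[mu]_(z in level T0) (W z * u z ^+ 2) <= 0.
Proof.
move=> T01; have [C [C_sym YC YAC CAC]] := pseudo_inverse A_sym lam_gt0 A_lower n.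
have [K K0 hK] := level_mass.
have [E E0 hE] := @step_bounded R.
have n2 : 2 <= n%:R :> R by rewrite ler_nat.
have dn : n%:R <= d%:R :> R by rewrite ler_nat.
pose m : R := a + d%:R + 2 * sigma - 2.
have m0 : 0 < m by move: an_lt2 dn; rewrite /m; lra.
have T00 : 0 < T0 by lra.
pose Bd := E * ((m + 2) * (m / 2 + 1) + 4 * (m / 2 * (m / 2 + 1) + m + 1)).
have m2 : 0 <= m / 2 by rewrite divr_ge0// ltW.
have Bd0 : 0 <= Bd.
  apply: mulr_ge0 => //; have := mulr_ge0 (ltW m0) m2; have := mulr_ge0 m2 m2; lra.
pose kap := flat 0 (flat 0 (1 : R)) * (m / 2 * (m + 2)) * (decay m T0 * inv1p T0 ^+ 2).
have T0p : 0 < 1 + T0 by lra.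
have kap0 : 0 < kap.
  apply: mulr_gt0.
    apply: mulr_gt0; first by do 2 apply: flat_gt0; rewrite ?ltr01.
    by apply: mulr_gt0; [exact: divr_gt0|exact: addr_gt0].
  by apply: mulr_gt0; [exact: powR_gt0|apply: exprn_gt0; exact: powR_gt0].
pose J := \int[mu]_(z in level T0) (W z * u z ^+ 2).
have W0 z : 0 <= W z * u z ^+ 2 by exact: mulr_ge0 (powR_ge0 _ _) (sqr_ge0 _).
have key T : 2 * T0 <= T ->
    kap * J <= Bd * 2 `^ (m / 2 + 1) * K * T `^ (- (sigma - gamma)).
  move=> T2; have T1 : 1 <= T by lra.
  have Tp : 0 < T by lra.
  pose k : R := 2 / T.
  have k0 : 0 < k by rewrite divr_gt0.
  pose r := Num.sqrt (Lam * T) + 1.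
  have r0 : 0 < r by rewrite ltr_wpDl ?sqrtr_ge0.
  have rT : Num.sqrt (Lam * T) < r by rewrite ltrDl.
  have [Du Hu weak] := u_sol r0.
  have q0 z : 0 <= qA A z by exact: (qA_ge0 A_sym lam_gt0 A_lower).
  have [b0 b1 b2] := @built_profile R m k d (qA A) (built_quadratic _ _) q0.
  have kT t : T <= t -> 2 <= k * t.
    by move=> Tt; rewrite /k mulrAC ler_pdivlMr// ler_pM2l.
  have [iL L0] := @weighted_energy_inequality R d n a eps r lam Lam T A C n_le_d eps_ge0 A_sym lam_gt0
    (ltW Lam_gt0) A_lower A_upper C_sym YC YAC CAC _ _ _ b0 b1 b2
    (is_derive_profile0 m k) (is_derive_profile1 m k) (fun t _ => profile0_ge0 m k t)
    (fun t Tt => (profile_out m (kT t Tt)).1) (fun t Tt => (profile_out m (kT t Tt)).2.1)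
    (fun z zT => le_lt_trans (enorm_le_sqrt (ltW Tp) zT) rT) u Du Hu weak.
  have hE' z : - (a + d%:R + 2 * sigma) * profile1 m k (qA A z) - 2 * qA A z * profile2 m k (qA A z)
     = profile_h m k (qA A z) by rewrite /profile_h /m subrK.
  have mO := @shell_measurable R d n eps r.
  have l0O : level T0 `<=` shell n eps r.
    apply: level_shell; first lra.
    by apply: le_lt_trans rT; rewrite ler_wsqrtr// ler_pM2l//; lra.
  have lO : level T `<=` shell n eps r by apply: level_shell => //; lra.
  have [i1 e1] := Rintegral_indic l0O mO (measurable_level T0) (level_integrable T01).
  have [i2 e2] := Rintegral_indic lO mO (measurable_level T) (level_integrable T1).
  have bnd z : shell n eps r z -> kap * (W z * u z ^+ 2 * \1_(level T0) z) <=
     W z * u z ^+ 2 * (- (a + d%:R + 2 * sigma) * profile1 m k (qA A z)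
        - 2 * qA A z * profile2 m k (qA A z))
     + Bd * k `^ (m / 2 + 1) * (W z * u z ^+ 2 * \1_(level T) z).
    move=> [_ Sz]; rewrite hE'; set w := W z * u z ^+ 2.
    have w0 : 0 <= w by exact: W0.
    have Bk : 0 <= Bd * k `^ (m / 2 + 1) by apply: mulr_ge0 => //; exact: powR_ge0.
    have lev t : (\1_(level t) z : R) = (qA A z <= t)%R%:R.
      rewrite indicE; congr (nat_of_bool _)%:R; apply/idP/idP => [/set_mem[]//|h].
      by apply/mem_set; split.
    rewrite !lev; set t := qA A z.
    have t0 : 0 <= t by exact: q0.
    have [kt1|kt1] := leP (k * t) 1.
      have R0 : 0 <= Bd * k `^ (m / 2 + 1) * (w * (t <= T)%R%:R).
        by apply: mulr_ge0 => //; apply: mulr_ge0.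
      have h0 : 0 <= decay m t * inv1p t ^+ 2.
        by apply: mulr_ge0; [exact: powR_ge0|exact: sqr_ge0].
      have c0 : 0 <= flat 0 (flat 0 (1 : R)) * (m / 2 * (m + 2)).
        apply: mulr_ge0; first exact: flat_ge0.
        by apply: mulr_ge0 => //; apply: addr_ge0 => //; exact: ltW.
      rewrite profile_h_inner//.
      have [tT0|tT0] := leP t T0; last first.
        by rewrite !mulr0; apply: addr_ge0 => //; apply: mulr_ge0 => //; exact: mulr_ge0.
      rewrite mulr1; apply: (@le_trans _ _ (w * (flat 0 (flat 0 1) * (m / 2 * (m + 2))
        * (decay m t * inv1p t ^+ 2)))); last by rewrite lerDl.
      rewrite mulrC ler_wpM2l// /kap ler_wpM2l//.
      have t1 : 0 < 1 + t by rewrite ltr_pwDl.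
      have tt : 1 + t <= 1 + T0 by rewrite lerD2l.
      apply: ler_pM; rewrite ?powR_ge0 ?sqr_ge0//.
        rewrite /decay !powRN lef_pV2 ?posrE ?powR_gt0//.
        by apply: ge0_ler_powR; rewrite ?nnegrE// ltW.
      rewrite lerXn2r ?nnegrE ?powR_ge0//.
      by rewrite /inv1p (powR_inv1 (ltW t1)) (powR_inv1 (ltW T0p)) lef_pV2 ?posrE.
    (* The point lies beyond T/2 >= T0, outside level T0. *)
    have T0t : (t <= T0) = false.
      apply/negbTE; rewrite -ltNge -(ltr_pM2l k0); apply: le_lt_trans kt1.
      by rewrite /k mulrAC ler_pdivrMr// mul1r.
    rewrite T0t !mulr0.
    have [kt2|kt2] := leP (k * t) 2.
      have tT : t <= T.
        by move: kt2; rewrite /k mulrAC ler_pdivrMr// ler_pM2l.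
      rewrite tT mulr1.
      have := profile_h_annulus m0 k0 hE (q0 z) (introT andP (conj (ltW kt1) kt2)).
      rewrite -/Bd -/t ler_norml => /andP[h1 _].
      have := ler_wpM2l w0 h1; lra.
    have -> : profile_h m k t = 0 by apply: profile_h_out; exact: ltW.
    rewrite mulr0 add0r.
    by apply: mulr_ge0 => //; apply: mulr_ge0.
  have := le_Rintegral mO (rintegrableZ mO kap i1)
    (rintegrableD mO iL (rintegrableZ mO (Bd * k `^ (m / 2 + 1)) i2)) bnd.
  rewrite (RintegralD mO iL (rintegrableZ mO (Bd * k `^ (m / 2 + 1)) i2)).
  rewrite (RintegralZl _ mO i1) (RintegralZl _ mO i2) e1 e2 -/J => kJ.
  have JT : \int[mu]_(z in level T) (W z * u z ^+ 2) <= K * T `^ (gamma + (d%:R + a) / 2).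
    rewrite -lee_fin /Rintegral fineK; first exact: hK.
    exact: (integrable_fin_num (measurable_level T) (level_integrable T1)).
  have Bk : 0 <= Bd * k `^ (m / 2 + 1) by apply: mulr_ge0 => //; exact: powR_ge0.
  have := ler_wpM2l Bk JT.
  have -> : Bd * k `^ (m / 2 + 1) * (K * T `^ (gamma + (d%:R + a) / 2)) =
      Bd * 2 `^ (m / 2 + 1) * K * T `^ (- (sigma - gamma)).
    have -> : - (sigma - gamma) = - (m / 2 + 1) + (gamma + (d%:R + a) / 2).
      by rewrite /m; field.
    have kE : k `^ (m / 2 + 1) = 2 `^ (m / 2 + 1) * T `^ (- (m / 2 + 1)).
      rewrite /k powRM ?invr_ge0 ?(ltW Tp)//; congr (_ * _).
      by rewrite -(powR_inv1 (ltW Tp)) -powRrM mulN1r.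
    rewrite kE [T `^ (_ + (gamma + _))]powRD; last by rewrite (lt0r_neq0 Tp) implybT.
    by ring.
  by move=> h1; move: kJ L0 h1; lra.
rewrite -/J leNgt; apply/negP => J0.
pose C1 := Bd * 2 `^ (m / 2 + 1) * K.
have C10 : 0 <= C1.
  by apply: mulr_ge0 => //; apply: mulr_ge0 => //; exact: powR_ge0.
have s0 : 0 < sigma - gamma by move: gamma_lt; lra.
have kJ : 0 < kap * J by exact: mulr_gt0.
pose x := (C1 + 1) / (kap * J).
have x0 : 0 < x by rewrite divr_gt0// ltr_wpDl.
(* T^(sigma - gamma) >= x makes the bound on kap * J smaller than kap * J. *)
pose T := 2 * T0 + x `^ ((sigma - gamma)^-1).
have xp : 0 <= x `^ ((sigma - gamma)^-1) by exact: powR_ge0.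
have T2 : 2 * T0 <= T by rewrite lerDl.
have Tp : 0 < T by lra.
have := key T T2; rewrite -/C1 powRN.
have xT : x <= T `^ (sigma - gamma).
  have -> : x = (x `^ ((sigma - gamma)^-1)) `^ (sigma - gamma).
    by rewrite -powRrM mulVf ?lt0r_neq0// powRr1// ltW.
  apply: ge0_ler_powR; rewrite ?nnegrE ?(ltW s0) ?(ltW Tp)//.
  by rewrite lerDr; lra.
rewrite ler_pdivlMr ?powR_gt0// => hJ.
have := le_trans (ler_wpM2l (ltW kJ) xT) hJ.
by rewrite /x mulrCA mulfV ?lt0r_neq0// mulr1 gerDl ler10.
Qed.

Lemma level_ae_zero T : 1 <= T ->
  {ae mu, forall z, level T z -> u z = 0}.
Proof.
move=> T1; have fi := level_integrable T1.
have mu_ : measurable_fun (level T) (EFin \o (fun z => W z * u z ^+ 2)).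
  by case/integrableP : fi.
have W0 z : 0 <= W z * u z ^+ 2 by exact: mulr_ge0 (powR_ge0 _ _) (sqr_ge0 _).
have I0 : (\int[mu]_(z in level T) `|(W z * u z ^+ 2)%:E| = 0)%E.
  under eq_integral do rewrite /= ger0_norm//.
  rewrite -(fineK (integrable_fin_num (measurable_level T) fi)); congr (_%:E); apply/eqP.
  rewrite eq_le level_vanish//=; apply: fine_ge0; apply: integral_ge0 => z _.
  by rewrite lee_fin.
have := (ae_eq_integral_abs mu (measurable_level T) mu_).1 I0.
apply: filterS => z hz lz; have /eqP := hz lz.
rewrite /= eqe mulf_eq0 sqrf_eq0 => /orP[|/eqP//].
have [Sz _] := lz; rewrite weight_powR => /eqP w0.
by have := powR_gt0 (a / 2) (notSigma_ysq eps_ge0 Sz); rewrite w0 ltxx.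
Qed.

End liouville.

Theorem theorem1p4 (R : realType) (d n : nat) (a eps : R) (A : 'M[R]_d)
    (lam Lam : R) (u : 'rV[R]_d -> R) (c gamma : R)
    (n_ge2 : (2 <= n)%N) (n_le_d : (n <= d)%N)
    (an_gt0 : 0 < a + n%:R) (an_lt2 : a + n%:R < 2)
    (eps_ge0 : 0 <= eps)
    (A_sym : A^T = A)
    (lam_gt0 : 0 < lam) (lam_le_Lam : lam <= Lam)
    (A_lower : forall xi : 'rV[R]_d, lam * enorm xi ^+ 2 <= dotr (mxact A xi) xi)
    (A_upper : forall xi : 'rV[R]_d, dotr (mxact A xi) xi <= Lam * enorm xi ^+ 2)
    (u_sol : entire_solution n a eps A u)
    (c_gt0 : 0 < c) (gamma_gt0 : 0 < gamma) (gamma_lt : gamma < 2 - a - n%:R)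
    (u_growth : {ae lebesgue_row d, forall z, ~ Sigma n eps z ->
       `|u z| <= c * (1 + enorm z `^ gamma)}) :
  {ae lebesgue_row d, forall z, ~ Sigma n eps z -> u z = 0}.
Proof.
have h j : {ae lebesgue_row d, forall z, level n eps A (j.+1)%:R z -> u z = 0}.
  apply: (level_ae_zero n_ge2 n_le_d an_gt0 an_lt2 eps_ge0 A_sym lam_gt0 lam_le_Lam
    A_lower A_upper u_sol c_gt0 gamma_gt0 gamma_lt u_growth).
  by rewrite ler1n.
have := ae_foralln h; apply: filterS => z hz Sz.
apply: (hz (Num.truncn (qA A z))); split => //=.
by apply: ltW; exact: truncnS_gt.
Qed.
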